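(* Let $\alpha\in(0,1)$ and let $\phi:[0,1]\to[0,\infty)$ be twice continuously differentiable on $(0,1]$ and such that there exist finite constants $W>0$, $c$, $c'$ with $$(2-\alpha)W p^{\alpha-2}+c'\le|\phi^{(2)}(p)|\le(2-\alpha)Wp^{\alpha-2}+c\qquad\text{for all }p\in(0,1].$$ If $n\gtrsim\frac{k^{1/\alpha}}{\ln k}$, and additionally $k\gtrsim(\ln n)^{4/3}$ in the case $\alpha\in(0,1/2]$, then $$R^*(n,k;\phi)\gtrsim\frac{k^2}{(n\ln n)^{2\alpha}}.$$
   Context: For an integer $k\ge1$, $\mathcal{M}_k$ denotes the set of probability vectors $P=(p_1,\dots,p_k)$ on $\{1,\dots,k\}$; $\theta(P)=\sum_{i=1}^k\phi(p_i)$. With $N\sim\mathrm{Multinomial}(n,P)$ the histogram of $n$ i.i.d. samples from $P$, $R^*(n,k;\phi)=\inf_{\hat\theta}\sup_{P\in\mathcal{M}_k}\mathbb{E}[(\hat\theta(N)-\theta(P))^2]$, infimum over all real-valued estimators of the histogram. $a\gtrsim b$ means $a\ge Cb$ for a positive constant $C$ not depending on $n,k$ (possibly depending on $\phi,\alpha$); a hypothesis $n\gtrsim f(k)$ means $n\ge c f(k)$ for a suitable positive constant $c$. Differentiability at $1$ is one-sided. *)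

(* Defs.v *)
From HB Require Import structures.
From mathcomp Require Import all_boot all_order all_algebra.
From mathcomp Require Import all_classical all_reals all_analysis.
Unset Printing Implicit Defensive.
Import Order.TTheory GRing.Theory Num.Theory.
Import numFieldNormedType.Exports.
Local Open Scope classical_set_scope.
Local Open Scope ring_scope.

Section Defs.
Variable R : realType.

Definition I01 : set R := [set x | 0 < x <= 1].

(* df is the derivative of f on (0,1], taken within (0,1]
   (so it is one-sided at 1). *)
Definition deriv_on_I01 (f df : R -> R) : Prop :=
  forall x, 0 < x <= 1 ->
    (fun y => (f y - f x) / (y - x)) @ within [set y | 0 < y <= 1 /\ y != x] (nbhs x)
      --> df x.

Definition C2_on_I01 (phi phi1 phi2 : R -> R) : Prop :=
  deriv_on_I01 phi phi1 /\ deriv_on_I01 phi1 phi2 /\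
  {within I01, continuous phi1} /\ {within I01, continuous phi2}.

Definition simplex (k : nat) : set ('I_k -> R) :=
  [set P | (forall i, 0 <= P i) /\ \sum_(i < k) P i = 1].

Definition theta (k : nat) (phi : R -> R) (P : 'I_k -> R) : R :=
  \sum_(i < k) phi (P i).

Definition histo (n k : nat) := {ffun 'I_k -> 'I_n.+1}.

Definition is_histo (n k : nat) (N : histo n k) : bool :=
  (\sum_(i < k) (N i : nat) == n)%N.

Definition multinom_pmf (n k : nat) (P : 'I_k -> R) (N : histo n k) : R :=
  (n`!)%:R / (\prod_(i < k) (N i)`!)%:R * \prod_(i < k) P i ^+ (N i : nat).

Definition risk (n k : nat) (phi : R -> R) (est : histo n k -> R)
    (P : 'I_k -> R) : R :=
  \sum_(N : histo n k | is_histo n k N) multinom_pmf n k P N * (est N - theta k phi P) ^+ 2.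

Definition minimax_risk (n k : nat) (phi : R -> R) : \bar R :=
  ereal_inf [set ereal_sup [set (risk n k phi est P)%:E | P in simplex k]
            | est in [set: histo n k -> R]].

End Defs.

(* Main.v *)
(* Le Cam's method.  All coordinates of P but the last are drawn independently,
   as a times a node of one of two finitely supported priors whose moments agree
   up to order m = 3 ln n and whose alpha-th moments differ by a constant; the
   last coordinate absorbs the remaining mass.  The priors are the positive and
   negative parts of a signed measure on 0, y, 1, 4, ..., m^2 (shifted by y):
   central binomial coefficients with alternating signs annihilate polynomials
   in j^2 of degree below m, and the point y gains one more degree.

   The growth condition on phi'' gives phi = A p^alpha + a Lipschitz function, so
   the two means of theta differ by about k a^alpha, of order k / (n ln n)^alpha.
   As a function of one coordinate x (with q - x in the last one) the multinomial
   pmf is the polynomial x^i (q - x)^j, majorized by x^i (q + x)^j; exchanging one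
   prior for the other in a single coordinate therefore moves the law of the
   histogram by at most 2 r^-(m+1) (1 + 2 r X)^n, X being the largest node.
   Exchanging the coordinates one after the other bounds the total variation
   distance between the two mixtures.

   The variance of theta under the priors is small only for k at least of order
   ln n (alpha <= 1/2) or (ln n)^3 (alpha > 1/2).  In the remaining case
   alpha > 1/2, k = O((ln n)^3), the claimed rate is below 1 / n, which two
   points at distance of order 1 / sqrt n already give. *)
Require Import Defs.
From HB Require Import structures.
From mathcomp Require Import all_boot all_order all_algebra.
From mathcomp Require Import all_classical all_reals all_analysis.
From mathcomp Require Import ring lra zify.
Set Implicit Arguments.
Unset Strict Implicit.
Unset Printing Implicit Defensive.
Import Order.TTheory GRing.Theory Num.Theory.
Import numFieldNormedType.Exports.
Local Open Scope classical_set_scope.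
Local Open Scope ring_scope.

(** * The multinomial theorem for histograms *)

Section Multinomial.
Variable R : realType.
Implicit Types (n k : nat).

(** Up to degree n the factors multiply like the series exp(P_i X), whose product is the exponential
    series of the total mass. Peeling off one factor is the binomial formula divided by l!. *)
Lemma coef_prod_truncated_exp n k (P : 'I_k -> R) l : (l <= n)%N ->
  (\prod_(i < k) \poly_(j < n.+1) (P i ^+ j / j`!%:R))`_l
  = (\sum_(i < k) P i) ^+ l / l`!%:R.
Proof.
elim: k P l => [|k IHk] P l le_ln.
  rewrite !big_ord0 coef1 expr0n.
  by case: l {le_ln} => [|l] /=; rewrite ?fact0 ?divr1 ?mul0r.
rewrite !big_ord_recl coefM addrC exprDn mulr_suml.
apply: eq_bigr => j _.
have le_jl : (j <= l)%N by rewrite -ltnS.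
rewrite IHk ?(leq_trans (leq_subr _ _))// coef_poly ltnS (leq_trans le_jl le_ln).
have nz i : i`!%:R != 0 :> R by rewrite pnatr_eq0 -lt0n fact_gt0.
have -> : l`!%:R = 'C(l, j)%:R * (j`!%:R * (l - j)`!%:R) :> R.
  by rewrite -!natrM bin_fact.
rewrite -[in RHS]mulr_natl.
have binz : 'C(l, j)%:R != 0 :> R by rewrite pnatr_eq0 -lt0n bin_gt0.
by field; rewrite binz !nz.
Qed.

(** Expanding the product over all functions N and reading off the coefficient of X^n keeps exactly
    the histograms of total n. It is applied also to majorants whose mass differs from 1. *)
Lemma sum_multinom_pmf n k (P : 'I_k -> R) :
  \sum_(N : histo n k | is_histo n k N) multinom_pmf R n k P N
  = (\sum_(i < k) P i) ^+ n.
Proof.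
have nz i : i`!%:R != 0 :> R by rewrite pnatr_eq0 -lt0n fact_gt0.
have := coef_prod_truncated_exp P (leqnn n).
move/(canLR (mulfVK (nz n))) <-.
rewrite (eq_bigr (fun i => \sum_(j < n.+1) (P i ^+ j / j`!%:R) *: 'X^j));
  last by move=> i _; rewrite poly_def.
rewrite (bigA_distr_bigA (fun i (j : 'I_n.+1) => (P i ^+ j / j`!%:R) *: 'X^j)) /=.
rewrite coef_sum mulr_suml big_mkcond /=; apply: eq_bigr => N _.
rewrite scaler_prod prodrXr coefZ coefXn /is_histo eq_sym.
case: ifP => _; last by rewrite mulr0 mul0r.
by rewrite mulr1 /multinom_pmf big_split/= natr_prod prodfV; ring.
Qed.

Lemma multinom_pmf_ge0 n k (P : 'I_k -> R) N :
  (forall i, 0 <= P i) -> 0 <= multinom_pmf R n k P N.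
Proof.
move=> P_ge0; rewrite /multinom_pmf mulr_ge0 ?divr_ge0 ?ler0n//.
by apply: prodr_ge0 => i _; rewrite exprn_ge0.
Qed.

End Multinomial.

(** * Polynomial majorants and the exchange of a prior in one coordinate *)

Section Swap.
Variable R : realType.
Implicit Types (p q P Q : {poly R}) (n k : nat).

Definition majorized p P := forall i, `|p`_i| <= P`_i.

Lemma majorized_mul p P q Q :
  majorized p P -> majorized q Q -> majorized (p * q) (P * Q).
Proof.
move=> pP qQ i; rewrite !coefM (le_trans (ler_norm_sum _ _ _))//.
by apply: ler_sum => j _; rewrite normrM ler_pM.
Qed.

Lemma majorized_exp p P a : majorized p P -> majorized (p ^+ a) (P ^+ a).
Proof.
move=> pP; elim: a => [|a IHa]; last by rewrite !exprS; exact: majorized_mul.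
by move=> i; rewrite !expr0 coef1; case: eqP; rewrite ?normr1 ?normr0.
Qed.

(** The moment condition removes all coefficients of degree at most m. For i > m one has x^i <= X^i
    <= r^-(m+1) (r X)^i because r >= 1, and summing against the majorant gives P(r X). *)
Lemma norm_sum_horner_le (J : finType) (w x : J -> R) m X r p P :
  (forall l, (l <= m)%N -> \sum_j w j * x j ^+ l = 0) ->
  (forall j, 0 <= x j <= X) -> 1 <= r -> majorized p P ->
  `|\sum_j w j * p.[x j]| <= (\sum_j `|w j|) / r ^+ m.+1 * P.[r * X].
Proof.
move=> mom xX r1 pP.
have r_gt0 : 0 < r by apply: lt_le_trans r1.
pose d := maxn (size p) (size P).
rewrite (@horner_coef_wide _ d P) ?leq_maxr//.
under eq_bigr do rewrite (@horner_coef_wide _ d p) ?leq_maxl// mulr_sumr.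
rewrite exchange_big /= (le_trans (ler_norm_sum _ _ _))// mulr_sumr.
apply: ler_sum => i _.
have -> : \sum_j w j * (p`_i * x j ^+ i) = p`_i * \sum_j w j * x j ^+ i.
  by rewrite mulr_sumr; apply: eq_bigr => j _; rewrite mulrCA.
rewrite normrM mulrCA ler_pM//.
have W0 : 0 <= \sum_j `|w j| by apply: sumr_ge0.
have [le_im|lt_mi] := leqP i m.
  rewrite mom// normr0.
  (* The sign of X is known only through some [x j]; for an empty J the total weight is 0. *)
  have [j0|noj] := pickP (fun _ : J => true); last first.
    by rewrite big_pred0// mul0r mul0r.
  have X0 : 0 <= X by have /andP[] := xX j0; exact: le_trans.
  by rewrite mulr_ge0 ?divr_ge0 ?exprn_ge0 ?mulr_ge0 ?(ltW r_gt0).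
rewrite (le_trans (ler_norm_sum _ _ _))// !mulr_suml; apply: ler_sum => j _.
have /andP[x0 xjX] := xX j.
rewrite normrM -mulrA ler_wpM2l// ger0_norm ?exprn_ge0//.
have X0 : 0 <= X by apply: le_trans xjX.
apply: (@le_trans _ _ (X ^+ i)); first by rewrite lerXn2r ?nnegrE.
rewrite exprMn mulrA ler_peMl ?exprn_ge0//.
by rewrite ler_pdivlMl ?exprn_gt0// mulr1 ler_weXn2l.
Qed.

Definition swap2 k (p : 'I_k -> R) i0 i1 a b : 'I_k -> R :=
  fun i => if i == i0 then a else if i == i1 then b else p i.

Lemma multinom_pmf_swap2 n k (p : 'I_k -> R) i0 i1 a b N : i0 != i1 ->
  multinom_pmf R n k (swap2 p i0 i1 a b) N =
  (n`!)%:R / (\prod_(i < k) (N i)`!)%:R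
  * (\prod_(i < k | (i != i0) && (i != i1)) p i ^+ N i)
  * (a ^+ N i0 * b ^+ N i1).
Proof.
move=> ne; rewrite /multinom_pmf -!mulrA; congr (_ * (_ * _)).
rewrite (bigD1 i0)//= (bigD1 i1) 1?eq_sym//= /swap2 eqxx.
rewrite [i1 == i0]eq_sym (negbTE ne) eqxx. rewrite mulrA mulrC; congr (_ * _).
by apply: eq_bigr => i /andP[/negbTE-> /negbTE->].
Qed.

(* Moving mass x from coordinate i1 to coordinate i0 turns the pmf into the
   polynomial x^a (q - x)^b, majorized by x^a (q + x)^b; the majorants again
   form a multinomial sum. *)
Lemma sum_norm_mixed_pmf_le n k (p : 'I_k -> R) i0 i1 (q : R)
    (J : finType) (w x : J -> R) m X r : i0 != i1 ->
  (forall i, 0 <= p i) -> 0 <= q -> 0 <= X ->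
  (forall l, (l <= m)%N -> \sum_j w j * x j ^+ l = 0) ->
  (forall j, 0 <= x j <= X) -> 1 <= r ->
  \sum_(N : histo n k | is_histo n k N)
     `|\sum_j w j * multinom_pmf R n k (swap2 p i0 i1 (x j) (q - x j)) N|
  <= (\sum_j `|w j|) / r ^+ m.+1
     * (\sum_(i < k | (i != i0) && (i != i1)) p i + q + 2 * (r * X)) ^+ n.
Proof.
move=> ne p0 q0 X0 mom xX r1.
set P := swap2 p i0 i1 (r * X) (q + r * X).
have -> : \sum_(i < k | (i != i0) && (i != i1)) p i + q + 2 * (r * X)
    = \sum_(i < k) P i.
  have <- : \sum_(i < k | (i != i0) && (i != i1)) P i
      = \sum_(i < k | (i != i0) && (i != i1)) p i.
    by apply: eq_bigr => i /andP[/negbTE n0 /negbTE n1]; rewrite /P /swap2 n0 n1.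
  rewrite [RHS](bigD1 i0)//= [X in _ = _ + X](bigD1 i1) 1?eq_sym//=.
  by rewrite {2 3}/P /swap2 !eqxx [i1 == i0]eq_sym (negbTE ne); ring.
rewrite -sum_multinom_pmf mulr_sumr; apply: ler_sum => N _.
set c := (n`!)%:R / (\prod_(i < k) (N i)`!)%:R
  * (\prod_(i < k | (i != i0) && (i != i1)) p i ^+ N i).
have c0 : 0 <= c.
  by rewrite mulr_ge0 ?divr_ge0 ?ler0n// prodr_ge0// => i _; rewrite exprn_ge0.
pose f : {poly R} := 'X ^+ N i0 * (q%:P - 'X) ^+ N i1.
pose F : {poly R} := 'X ^+ N i0 * (q%:P + 'X) ^+ N i1.
have fF : majorized f F.
  apply: majorized_mul; apply: majorized_exp => i.
    by rewrite coefX; case: eqP; rewrite ?normr1 ?normr0.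
  rewrite coefB coefD coefC coefX (le_trans (ler_normB _ _))//.
  by case: (i == 0)%N; case: (i == 1)%N => /=; rewrite !ger0_norm.
have -> : \sum_j w j * multinom_pmf R n k (swap2 p i0 i1 (x j) (q - x j)) N
    = c * \sum_j w j * f.[x j].
  rewrite mulr_sumr; apply: eq_bigr => j _.
  have -> : f.[x j] = x j ^+ N i0 * (q - x j) ^+ N i1 by rewrite /f !hornerE.
  by rewrite multinom_pmf_swap2// -/c mulrCA.
rewrite normrM ger0_norm// /P multinom_pmf_swap2// -/c.
have -> : (r * X) ^+ N i0 * (q + r * X) ^+ N i1 = F.[r * X].
  by rewrite /F !hornerE.
by rewrite [leRHS]mulrCA ler_wpM2l// norm_sum_horner_le.
Qed.

End Swap.

(** * Independent draws from a finitely supported prior *)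

Section IteratedExpectation.
Variables (R : realType) (J : finType).
Implicit Types (mu : J -> R) (K : nat) (g h : seq J -> R).

(** Expectation over K independent draws with weights mu. Nesting the sums, with the draws collected
    in a sequence, turns one-coordinate arguments into inductions on K. *)
Fixpoint iexp mu K g : R :=
  if K is K'.+1 then \sum_j mu j * iexp mu K' (fun s => g (j :: s)) else g [::].

Lemma eq_iexp mu K g h : (forall s, size s = K -> g s = h s) ->
  iexp mu K g = iexp mu K h.
Proof.
elim: K g h => [|K IHK] g h gh /=; first exact: gh.
by apply: eq_bigr => j _; congr (_ * _); apply: IHK => s sK; rewrite gh //= sK.
Qed.

Lemma iexpD mu K g h :
  iexp mu K (fun s => g s + h s) = iexp mu K g + iexp mu K h.
Proof.
elim: K g h => [|K IHK] g h //=.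
by rewrite -big_split; apply: eq_bigr => j _; rewrite IHK mulrDr.
Qed.

Lemma iexpZ mu K a g : iexp mu K (fun s => a * g s) = a * iexp mu K g.
Proof.
elim: K g => [|K IHK] g //=.
by rewrite mulr_sumr; apply: eq_bigr => j _; rewrite IHK mulrCA.
Qed.

Lemma iexp_sum (I : finType) (P : pred I) mu K (G : I -> seq J -> R) :
  iexp mu K (fun s => \sum_(i | P i) G i s) = \sum_(i | P i) iexp mu K (G i).
Proof.
elim: K G => [|K IHK] G //=; rewrite exchange_big /=.
by apply: eq_bigr => j _; rewrite IHK mulr_sumr.
Qed.

Lemma le_iexp mu K g h : (forall j, 0 <= mu j) ->
  (forall s, size s = K -> g s <= h s) -> iexp mu K g <= iexp mu K h.
Proof.
move=> mu0; elim: K g h => [|K IHK] g h gh /=; first exact: gh.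
apply: ler_sum => j _; rewrite ler_wpM2l//.
by apply: IHK => s sK; rewrite gh //= sK.
Qed.

Lemma norm_iexp_le mu K g : (forall j, 0 <= mu j) ->
  `|iexp mu K g| <= iexp mu K (fun s => `|g s|).
Proof.
move=> mu0; elim: K g => [|K IHK] g //=.
rewrite (le_trans (ler_norm_sum _ _ _))//; apply: ler_sum => j _.
by rewrite normrM ger0_norm// ler_wpM2l.
Qed.

Section Probability.
Variable mu : J -> R.
Hypothesis mu1 : \sum_j mu j = 1.

Lemma iexp_cst K a : iexp mu K (fun=> a) = a.
Proof.
by elim: K => [|K IHK] //=; rewrite IHK -mulr_suml mu1 mul1r.
Qed.

Variable f : J -> R.
Let E := \sum_j mu j * f j.
Let V := \sum_j mu j * (f j - E) ^+ 2.

Let sum_centered : \sum_j mu j * (f j - E) = 0.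
Proof.
under eq_bigr do rewrite mulrBr.
by rewrite sumrB -mulr_suml mu1 mul1r subrr.
Qed.

Lemma iexp_centered K : iexp mu K (fun s => \sum_(j <- s) (f j - E)) = 0.
Proof.
elim: K => [|K IHK] /=; first by rewrite big_nil.
under eq_bigr => j _.
  under [X in mu j * X]eq_iexp do rewrite big_cons.
  rewrite iexpD IHK iexp_cst addr0; over.
exact: sum_centered.
Qed.

Lemma iexp_variance K :
  iexp mu K (fun s => (\sum_(j <- s) (f j - E)) ^+ 2) = K%:R * V.
Proof.
elim: K => [|K IHK] /=; first by rewrite big_nil expr0n mul0r.
transitivity (\sum_j (mu j * (f j - E) ^+ 2 + mu j * (K%:R * V))).
  apply: eq_bigr => j _; rewrite -mulrDr; congr (_ * _).
  rewrite (@eq_iexp _ _ _ (fun s => (f j - E) ^+ 2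
    + ((2 * (f j - E)) * \sum_(j <- s) (f j - E)
       + (\sum_(j <- s) (f j - E)) ^+ 2))); last first.
    by move=> s _; rewrite big_cons; ring.
  by rewrite !iexpD iexpZ iexp_centered IHK iexp_cst mulr0 add0r.
rewrite big_split /= -mulr_suml mu1 mul1r -/V -[K.+1]addn1 natrD; ring.
Qed.

Lemma variance_le_moment2 : V <= \sum_j mu j * f j ^+ 2.
Proof.
suff -> : V = \sum_j mu j * f j ^+ 2 - E ^+ 2 by rewrite gerBl sqr_ge0.
transitivity (\sum_j (mu j * f j ^+ 2 - 2 * E * (mu j * f j) + mu j * E ^+ 2)).
  by apply: eq_bigr => j _; ring.
by rewrite big_split sumrB -mulr_sumr -mulr_suml mu1 -/E /=; ring.
Qed.

End Probability.

(** Hybrid argument: mu0 is replaced by mu1 in one draw at a time. Each of the K replacements costs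
    at most e, uniformly in the values s and t of the other draws. *)
Lemma sum_norm_iexp_sub (I : finType) (P : pred I) (G : I -> seq J -> R)
    mu0 mu1 K e :
  (forall j, 0 <= mu0 j) -> (forall j, 0 <= mu1 j) ->
  \sum_j mu0 j = 1 -> \sum_j mu1 j = 1 ->
  (forall s t, (size s + size t).+1 = K ->
     \sum_(i | P i) `|\sum_j (mu1 j - mu0 j) * G i (s ++ j :: t)| <= e) ->
  \sum_(i | P i) `|iexp mu1 K (G i) - iexp mu0 K (G i)| <= K%:R * e.
Proof.
move=> mu0_ge0 mu1_ge0 sum0 sum1; elim: K G => [|K IHK] G He.
  by rewrite mul0r big1// => i _; rewrite subrr normr0.
(* [A] exchanges the tail with the head drawn from mu0; [B] exchanges the head with the tail already
   drawn from mu1. *)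
pose A i := \sum_j mu0 j * (iexp mu1 K (fun s => G i (j :: s))
                            - iexp mu0 K (fun s => G i (j :: s))).
pose B i := iexp mu1 K (fun s => \sum_j (mu1 j - mu0 j) * G i (j :: s)).
have AB i : iexp mu1 K.+1 (G i) - iexp mu0 K.+1 (G i) = A i + B i.
  rewrite /A /B iexp_sum /= -sumrB -big_split /=.
  by apply: eq_bigr => j _; rewrite iexpZ; ring.
apply: (@le_trans _ _ (\sum_(i | P i) (`|A i| + `|B i|))).
  by apply: ler_sum => i _; rewrite AB ler_normD.
rewrite big_split /= -natr1 mulrDl mul1r; apply: lerD.
  apply: (@le_trans _ _ (\sum_j mu0 j * (K%:R * e))); last first.
    by rewrite -mulr_suml sum0 mul1r.
  apply: (@le_trans _ _ (\sum_j mu0 j * \sum_(i | P i)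
      `|iexp mu1 K (fun s => G i (j :: s)) - iexp mu0 K (fun s => G i (j :: s))|)).
    under [leRHS]eq_bigr do rewrite mulr_sumr.
    rewrite exchange_big /=; apply: ler_sum => i _.
    rewrite (le_trans (ler_norm_sum _ _ _))//; apply: ler_sum => j _.
    by rewrite normrM ger0_norm.
  apply: ler_sum => j _; rewrite ler_wpM2l//.
  apply: (IHK (fun i s => G i (j :: s))) => s t st.
  by apply: (He (j :: s) t); rewrite /= -st.
apply: (@le_trans _ _ (iexp mu1 K (fun s =>
    \sum_(i | P i) `|\sum_j (mu1 j - mu0 j) * G i (j :: s)|))).
  by rewrite iexp_sum; apply: ler_sum => i _; exact: norm_iexp_le.
rewrite -[leRHS](iexp_cst sum1 K); apply: le_iexp => // s sK.
by apply: (He [::] s); rewrite /= sK.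
Qed.

End IteratedExpectation.

(** * Signed weights that annihilate polynomials of low degree *)

Section SignedWeights.
Variable R : realType.
Implicit Types (p q : {poly R}) (m : nat).

(** Up to sign this is the N-th finite difference, which kills degrees below N. *)
Lemma sum_alternating_binomial_horner N p : (size p <= N)%N ->
  \sum_(i < N.+1) (-1) ^+ i * 'C(N, i)%:R * p.[i%:R] = 0.
Proof.
elim: N p => [|N IHN] p.
  by rewrite leqn0 size_poly_eq0 => /eqP->; rewrite big1// => i _; rewrite horner0 mulr0.
elim/poly_ind: p => [|q c _] sz.
  by rewrite big1// => i _; rewrite horner0 mulr0.
have szq : (size q <= N)%N.
  move: sz; rewrite size_MXaddC; case: ifP => //.
  by case/andP => /eqP-> _; rewrite size_poly0.
have bin0 : \sum_(i < N.+2) (-1) ^+ i * 'C(N.+1, i)%:R = 0 :> R.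
  transitivity ((1 - 1 : R) ^+ N.+1); last by rewrite subrr expr0n.
  rewrite exprDn; apply: eq_bigr => i _.
  by rewrite expr1n mul1r mulr_natr.
transitivity (\sum_(i < N.+2) (-1) ^+ i * 'C(N.+1, i)%:R * (q.[i%:R] * i%:R)
   + c * \sum_(i < N.+2) (-1) ^+ i * 'C(N.+1, i)%:R).
  by rewrite mulr_sumr -big_split; apply: eq_bigr => i _; rewrite /= hornerMXaddC; ring.
rewrite bin0 mulr0 addr0 big_ord_recl mulr0 mulr0 add0r.
(* The identity i C(N+1, i) = (N+1) C(N, i-1) absorbs the factor X of p = q X + c; shifting the
   index turns q into q(X + 1). *)
transitivity (- N.+1%:R * \sum_(i < N.+1) (-1) ^+ i * 'C(N, i)%:R
    * (q \Po ('X + 1%:P)).[i%:R]); last first.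
  by rewrite IHN ?mulr0// size_comp_poly2// size_XaddC.
rewrite mulr_sumr; apply: eq_bigr => i _.
rewrite horner_comp !hornerE lift0 natr1.
have := congr1 (fun k : nat => k%:R : R) (mul_bin_diag N.+1 i).
rewrite !natrM /= exprS => H.
transitivity (- ((-1) ^+ i) * (i.+1%:R * 'C(N.+1, i.+1)%:R) * q.[i.+1%:R]).
  by ring.
by rewrite -H; ring.
Qed.

(** Weight of the node (j+1)^2: the alternating row C(2m, i), read from its centre i = m and
    normalized so that the node 0 has weight 1. *)
Definition half_weight m j : R :=
  (-1) ^+ j.+1 * 'C(m.*2, m + j.+1)%:R / 'C(m.*2, m)%:R.

(** The polynomial q((X - m)^2) has degree at most 2m - 2, so the 2m-th difference kills it. Folding
    that sum about i = m identifies the terms i = m + j + 1 and i = m - j - 1, whence the factor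
    2. *)
Lemma sum_half_weight_horner m q : (0 < m)%N -> (size q <= m)%N ->
  q.[0] + 2 * \sum_(j < m) half_weight m j * q.[j.+1%:R ^+ 2] = 0.
Proof.
move=> m_gt0 szq.
pose p := q \Po (('X - m%:R%:P) ^+ 2).
have szp : (size p <= m.*2)%N.
  rewrite /p; have [->|q0] := eqVneq q 0; first by rewrite comp_poly0 size_poly0.
  have q1 : (0 < size q)%N by rewrite size_poly_gt0.
  rewrite (leq_trans (size_comp_poly_leq _ _))// size_exp_XsubC /=.
  by move: szq q1; set a := size q; lia.
have := sum_alternating_binomial_horner szp.
have pE i : p.[i%:R] = q.[(i%:R - m%:R) ^+ 2] by rewrite /p horner_comp !hornerE.
pose F i : R := (-1) ^+ i * 'C(m.*2, i)%:R * p.[i%:R].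
rewrite -(big_mkord xpredT F) (@big_cat_nat _ _ _ m) //=; last by lia.
rewrite [X in _ + X]big_ltn; last by lia.
have E1 : \sum_(0 <= i < m) F i
    = \sum_(j < m) (-1) ^+ m * 'C(m.*2, m)%:R * (half_weight m j * q.[j.+1%:R ^+ 2]).
  rewrite big_nat_rev /= add0n big_mkord; apply: eq_bigr => -[j jm] _ /=.
  rewrite /F pE /half_weight.
  have -> : 'C(m.*2, m - j.+1) = 'C(m.*2, m + j.+1).
    by rewrite -bin_sub ?leq_subLR; [congr ('C(_, _)); lia|lia].
  rewrite natrB// -[X in q.[X]]sqrrN opprB subKr.
  have -> : (-1) ^+ (m - j.+1) = (-1) ^+ m * (-1) ^+ j.+1 :> R.
    by rewrite -signr_odd oddB// signr_addb !signr_odd.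
  have ? : 'C(m.*2, m)%:R != 0 :> R by rewrite pnatr_eq0 -lt0n bin_gt0; lia.
  by field.
have E2 : \sum_(m.+1 <= i < m.*2.+1) F i
    = \sum_(j < m) (-1) ^+ m * 'C(m.*2, m)%:R * (half_weight m j * q.[j.+1%:R ^+ 2]).
  rewrite -{1}[m.+1]add0n big_addn.
  have -> : (m.*2.+1 - m.+1 = m)%N by lia.
  rewrite big_mkord; apply: eq_bigr => j _.
  rewrite /F pE /half_weight addnS -addSn addnC natrD addrC addKr exprD.
  have ? : 'C(m.*2, m)%:R != 0 :> R by rewrite pnatr_eq0 -lt0n bin_gt0; lia.
  by field.
rewrite E1 E2 -!mulr_sumr {1}/F pE subrr expr0n /=.
set S := \sum_(j < m) _; set C : R := 'C(_, _)%:R; set e := (-1) ^+ m => H.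
have C0 : C != 0 by rewrite pnatr_eq0 -lt0n bin_gt0; lia.
have : e * C * (q.[0] + 2 * S) = 0 by rewrite -[RHS]H; ring.
by move/eqP; rewrite !mulf_eq0 signr_eq0 (negbTE C0) /= => /eqP.
Qed.

Definition node (y : R) m (j : 'I_m.+2) : R :=
  match val j with 0 => 0 | 1 => y | i.+2 => i.+1%:R ^+ 2 end.

(* For deg p <= m the quotient (p(x) - p(y)) / (x - y) has degree < m, so the
   identity for half_weight applies to it. *)
Definition weight (y : R) m (j : 'I_m.+2) : R :=
  match val j with
  | 0 => - y^-1
  | 1 => y^-1 - \sum_(i < m) 2 * half_weight m i / (i.+1%:R ^+ 2 - y)
  | i.+2 => 2 * half_weight m i / (i.+1%:R ^+ 2 - y)
  end.

Lemma sum_weight y m : \sum_j weight y (j : 'I_m.+2) = 0.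
Proof. by rewrite !big_ord_recl /weight /=; ring. Qed.

(** As the weights sum to 0, f may be replaced by f - f(y), which removes the node y and leaves a
    combination of divided differences of f at y. *)
Lemma sum_weight_sub y m (f : R -> R) :
  \sum_j weight y j * f (node y (j : 'I_m.+2))
  = (f y - f 0) / y + 2 * \sum_(i < m)
      half_weight m i * ((f (i.+1%:R ^+ 2) - f y) / (i.+1%:R ^+ 2 - y)).
Proof.
transitivity (\sum_j weight y (j : 'I_m.+2) * (f (node y j) - f y)).
  under [RHS]eq_bigr do rewrite mulrBr.
  by rewrite sumrB -mulr_suml sum_weight mul0r subr0.
rewrite !big_ord_recl /weight /node /= subrr mulr0 add0r mulr_sumr.
congr (_ + _); first by ring.
by apply: eq_bigr => i _; ring.
Qed.

Lemma sum_weight_horner y m p : (0 < m)%N -> 0 < y < 1 -> (size p <= m.+1)%N ->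
  \sum_j weight y j * p.[node y (j : 'I_m.+2)] = 0.
Proof.
move=> m_gt0 /andP[y0 y1] szp; rewrite (sum_weight_sub y m (horner p)).
have rt : root (p - p.[y]%:P) y by rewrite rootE !hornerE subrr.
have /factor_theorem[q pq] := rt.
have qE x : p.[x] - p.[y] = q.[x] * (x - y).
  have := congr1 (horner^~ x) pq; by rewrite !hornerE.
have szq : (size q <= m)%N.
  have [->|q0] := eqVneq q 0; first by rewrite size_poly0.
  have : (size (p - p.[y]%:P)%R <= m.+1)%N.
    rewrite (leq_trans (size_polyD _ _))// size_polyN geq_max szp.
    by rewrite (leq_trans (size_polyC_leq1 _)).
  by rewrite pq size_Mmonic ?monicXsubC// size_XsubC addn2.
rewrite -[RHS](sum_half_weight_horner m_gt0 szq); congr (_ + 2 * _).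
  rewrite -opprB qE sub0r mulrN opprK mulfK ?gt_eqF//.
apply: eq_bigr => i _; rewrite qE mulfK// subr_eq0 gt_eqF//.
by rewrite (lt_le_trans y1)// -natrX ler1n expn_gt0.
Qed.

End SignedWeights.

(** * Size of the weights and the gap in the moment of order alpha *)

Section WeightBounds.
Variable R : realType.
Implicit Types (m : nat) (a y : R).

Lemma sum_alternating_bounds (h : nat -> R) m :
  (forall i, 0 <= h i) -> (forall i, h i.+1 <= h i) ->
  0 <= \sum_(i < m) (-1) ^+ i * h i <= h 0%N.
Proof.
elim: m h => [|m IHm] h h0 hS; first by rewrite big_ord0 lexx h0.
rewrite big_ord_recl expr0 mul1r.
have -> : \sum_(i < m) (-1) ^+ lift ord0 i * h (lift ord0 i)
    = - \sum_(i < m) (-1) ^+ i * h i.+1.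
  by rewrite -sumrN; apply: eq_bigr => i _; rewrite lift0 exprS; ring.
have /andP[S0 S1] := IHm (fun i => h i.+1) (fun i => h0 _) (fun i => hS _).
by have := hS 0%N; rewrite /= in S1 *; lra.
Qed.

Definition bin_ratio m j : R := 'C(m.*2, m + j.+1)%:R / 'C(m.*2, m)%:R.

Let bin_gt0R m : 0 < 'C(m.*2, m)%:R :> R.
Proof. by rewrite ltr0n bin_gt0 -addnn leq_addr. Qed.

Lemma bin_ratio_ge0 m j : 0 <= bin_ratio m j.
Proof. by rewrite /bin_ratio divr_ge0. Qed.

Let bin_right_decr m M : (m <= M)%N -> ('C(m.*2, M.+1) <= 'C(m.*2, M))%N.
Proof.
move=> mM; rewrite -(leq_pmul2l (ltn0Sn M)) mul_bin_left leq_mul2r.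
by apply/orP; right; lia.
Qed.

Lemma bin_ratioS m j : bin_ratio m j.+1 <= bin_ratio m j.
Proof.
rewrite /bin_ratio ler_wpM2r// ?invr_ge0// ler_nat addnS bin_right_decr//.
exact: leq_addr.
Qed.

Lemma bin_ratio_le1 m j : bin_ratio m j <= 1.
Proof.
elim: j => [|j]; last by apply: le_trans; exact: bin_ratioS.
by rewrite /bin_ratio ler_pdivrMr// mul1r ler_nat addn1 bin_right_decr.
Qed.

Lemma half_weightE m j : half_weight R m j = - ((-1) ^+ j * bin_ratio m j).
Proof. by rewrite /half_weight /bin_ratio exprS; ring. Qed.

(** From u to v the numerator grows by the factor t^a <= t with t = (v + y) / (u + y) >= 1, and (v +
    y) / (v - y) decreases in v. *)
Lemma powR_div_sub_decr a y u v : 0 <= a <= 1 -> 0 <= y < u -> u <= v ->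
  (v + y) `^ a / (v - y) <= (u + y) `^ a / (u - y).
Proof.
move=> /andP[a0 a1] /andP[y0 yu] uv.
have u0 : 0 < u + y by lra.
have dv : 0 < v - y by lra.
have du : 0 < u - y by lra.
have t1 : 1 <= (v + y) / (u + y) by rewrite ler_pdivlMr//; lra.
have -> : v + y = (u + y) * ((v + y) / (u + y)) by field; lra.
rewrite powRM; [|lra|lra].
rewrite -mulrA ler_wpM2l ?powR_ge0// ler_pdivrMr// [leRHS]mulrC ler_pdivlMr//.
apply: (@le_trans _ _ ((v + y) / (u + y) * (u - y))).
  by rewrite ler_wpM2r ?(ltW du)// -[leRHS]powRr1 ?ler_powR//; lra.
by rewrite mulrAC ler_pdivrMr//; nra.
Qed.

(** After the shift the two smallest nodes lie at y and 2y, and their divided difference is the main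
    term (2^a - 1) y^(a-1). The other nodes enter through alternating sums with decreasing terms, so
    they cost a constant uniform in m. *)
Lemma weight_gap a y m : 0 < a < 1 -> 0 < y <= 1 / 2 ->
  (2 `^ a - 1) * y `^ (a - 1) - 8
  <= \sum_j weight y j * (node y (j : 'I_m.+2) + y) `^ a.
Proof.
move=> /andP[a0 a1] /andP[y0 y12].
rewrite (sum_weight_sub y m (fun x => (x + y) `^ a)) add0r; apply: lerD.
  have -> : y + y = 2 * y by ring.
  rewrite powRM ?ler0n ?(ltW y0)// powRD; last by apply/implyP => _; rewrite gt_eqF.
  by rewrite powRN powRr1 ?(ltW y0)//; lra.
pose s i : R := i.+1%:R ^+ 2.
have sS i : s i <= s i.+1 by rewrite /s lerXn2r ?nnegrE ?ler0n// ler_nat.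
have s1 i : 1 <= s i by rewrite /s -natrX ler1n expn_gt0.
have sy i : 0 < s i - y by have := s1 i; lra.
pose h i := bin_ratio m i * ((s i + y) `^ a / (s i - y)).
pose g i := bin_ratio m i / (s i - y).
(* Splitting each numerator gives two alternating sums: the one with [g] is nonnegative and is
   dropped, the one with [h] is at most h 0 <= 4. With the factor 2 in front the loss is 8. *)
have -> : \sum_(i < m) half_weight R m i
      * (((s i + y) `^ a - (y + y) `^ a) / (s i - y))
    = (y + y) `^ a * (\sum_(i < m) (-1) ^+ i * g i)
      - \sum_(i < m) (-1) ^+ i * h i.
  rewrite mulr_sumr -sumrB; apply: eq_bigr => i _.
  by rewrite half_weightE /g /h; ring.
have /andP[H0 H1] : 0 <= \sum_(i < m) (-1) ^+ i * h i <= h 0%N.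
  apply: sum_alternating_bounds => i; rewrite /h.
    by rewrite mulr_ge0 ?bin_ratio_ge0 ?divr_ge0 ?powR_ge0 ?(ltW (sy i)).
  rewrite ler_pM ?bin_ratio_ge0 ?bin_ratioS ?divr_ge0 ?powR_ge0 ?(ltW (sy _))//.
  rewrite powR_div_sub_decr// ?(ltW a0) ?(ltW a1) ?(ltW y0)//=.
  by have := sy i; lra.
have /andP[G0 _] : 0 <= \sum_(i < m) (-1) ^+ i * g i <= g 0%N.
  apply: sum_alternating_bounds => i; rewrite /g.
    by rewrite divr_ge0 ?bin_ratio_ge0 ?(ltW (sy i)).
  rewrite ler_pM ?bin_ratio_ge0 ?bin_ratioS ?invr_ge0 ?(ltW (sy _))//.
  by rewrite lef_pV2 ?posrE ?sy// lerD2r.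
have h4 : h 0%N <= 4.
  have : (1 + y) `^ a <= 2.
    rewrite (@le_trans _ _ ((1 + y) `^ 1))// ?ler_powR ?(ltW a1)//; [lra|].
    by rewrite powRr1; lra.
  have : (1 - y)^-1 <= 2 by rewrite -[leRHS]invrK lef_pV2 ?posrE; lra.
  have : 0 <= (1 - y)^-1 by rewrite invr_ge0; lra.
  have := powR_ge0 (1 + y) a.
  rewrite /h /s expr1n; set A := (1 + y) `^ a; set B := (1 - y)^-1.
  move=> A0 B0 B2 A2; have : A * B <= 2 * 2 by rewrite ler_pM.
  have : bin_ratio m 0 * (A * B) <= 1 * (A * B).
    by rewrite ler_wpM2r ?mulr_ge0 ?bin_ratio_le1.
  by lra.
have : 0 <= (y + y) `^ a * (\sum_(i < m) (-1) ^+ i * g i).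
  by rewrite mulr_ge0 ?powR_ge0.
by move: H0 H1 h4; lra.
Qed.

Lemma sum_inv_sqr_le2 m : \sum_(i < m) (i.+1%:R ^+ 2)^-1 <= 2 :> R.
Proof.
case: m => [|m]; first by rewrite big_ord0.
suff : \sum_(i < m.+1) (i.+1%:R ^+ 2)^-1 <= 2 - m.+1%:R^-1 :> R.
  by move/le_trans; apply; rewrite gerBl.
elim: m => [|m IHm]; first by rewrite big_ord1 expr1n !invr1; lra.
rewrite big_ord_recr /= (le_trans (lerD IHm (lexx _)))//.
have : (m.+2%:R ^+ 2)^-1 <= m.+1%:R^-1 - m.+2%:R^-1 :> R.
  have -> : m.+2%:R = m.+1%:R + 1 :> R by rewrite natr1.
  have : 0 < m.+1%:R :> R by rewrite ltr0n.
  move: (m.+1%:R : R) => z z0.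
  have -> : z^-1 - (z + 1)^-1 = (z * (z + 1))^-1 by field; lra.
  by rewrite lef_pV2 ?posrE ?mulr_gt0 ?exprn_gt0//; nra.
by move: (m.+2%:R ^- 2 : R) (m.+1%:R^-1 : R) (m.+2%:R^-1 : R) => u v w; lra.
Qed.

Lemma norm_weight_le y m i : 0 < y <= 1 / 2 ->
  `|2 * half_weight R m i / (i.+1%:R ^+ 2 - y)| <= 4 * (i.+1%:R ^+ 2)^-1.
Proof.
move=> /andP[y0 y12].
have : 1 <= i.+1%:R ^+ 2 :> R by rewrite -natrX ler1n expn_gt0.
move: (i.+1%:R ^+ 2) => s s1.
rewrite half_weightE mulrN mulNr normrN mulrCA -mulrA normrM normrX normrN1 expr1n.
have B0 := bin_ratio_ge0 m i; have B1 := bin_ratio_le1 m i.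
rewrite mul1r ger0_norm; last by rewrite !mulr_ge0 ?invr_ge0//; lra.
have : (s - y)^-1 <= 2 * s^-1.
  by rewrite -[2]invrK -invfM lef_pV2 ?posrE; lra.
have : 0 <= (s - y)^-1 by rewrite invr_ge0; lra.
by nra.
Qed.

Lemma norm_weight1_le y m : 0 < y <= 1 / 2 ->
  `|weight y (lift ord0 ord0 : 'I_m.+2)| <= y^-1 + 8.
Proof.
move=> y12; have /andP[y0 _] := y12.
rewrite /weight /= (le_trans (ler_normB _ _))//.
rewrite ger0_norm ?invr_ge0 ?(ltW y0)// lerD2l (le_trans (ler_norm_sum _ _ _))//.
apply: (@le_trans _ _ (\sum_(i < m) 4 * (i.+1%:R ^+ 2)^-1)).
  by apply: ler_sum => i _; exact: norm_weight_le.
by rewrite -mulr_sumr; have := sum_inv_sqr_le2 m; lra.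
Qed.

Lemma sum_norm_weight_le y m : 0 < y <= 1 / 2 ->
  \sum_j `|weight y (j : 'I_m.+2)| <= 2 / y + 16.
Proof.
move=> y12; have /andP[y0 _] := y12.
have w0 : `|weight y (ord0 : 'I_m.+2)| = y^-1.
  by rewrite /weight /= normrN ger0_norm ?invr_ge0 ?(ltW y0).
rewrite !big_ord_recl w0; have := norm_weight1_le m y12.
have : \sum_(i < m) `|weight y (lift ord0 (lift ord0 i))| <= 8.
  apply: (@le_trans _ _ (\sum_(i < m) 4 * (i.+1%:R ^+ 2)^-1)).
    by apply: ler_sum => i _; exact: norm_weight_le.
  by rewrite -mulr_sumr; have := sum_inv_sqr_le2 m; lra.
by move: (\sum_(i < m) _) (`|_|) (y^-1) => u v w; lra.
Qed.

(** Power of m in the bound on the second moment of x^a. The node i^2 contributes about i^-2 (i^2 +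
    y)^(2a), which is O(1) if 2a <= 1 and O(m^2) otherwise, and there are m such nodes. *)
Definition moment_exponent a : nat := if a <= 1 / 2 then 1 else 3.

Lemma sum_norm_weight_powR2_le a y m : (0 < m)%N -> 0 < a < 1 -> 0 < y <= 1 / 2 ->
  \sum_j `|weight y j| * ((node y (j : 'I_m.+2) + y) `^ a) ^+ 2
  <= (2 / y + 24) * m%:R ^+ moment_exponent a.
Proof.
move=> m_gt0 /andP[a0 a1] y12; have /andP[y0 yle] := y12.
set e := moment_exponent a.
have powR_sqr_le1 x : 0 <= x <= 1 -> (x `^ a) ^+ 2 <= 1.
  move=> /andP[x0 x1]; rewrite expr_le1// ?powR_ge0//.
  have : x `^ a <= 1 `^ a by rewrite ge0_ler_powR ?nnegrE//; lra.
  by rewrite powR1.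
have me : 1 <= m%:R ^+ e :> R by rewrite -natrX ler1n expn_gt0 m_gt0.
have tail : \sum_(i < m) `|weight y (lift ord0 (lift ord0 i))|
    * ((node y (lift ord0 (lift ord0 i : 'I_m.+1)) + y) `^ a) ^+ 2
    <= 16 * m%:R ^+ e.
  have -> : 16 * m%:R ^+ e = \sum_(i < m) 16 * m%:R ^+ e.-1 :> R.
    rewrite sumr_const card_ord -[RHS]mulr_natl mulrCA -exprS.
    by rewrite prednK// /e /moment_exponent; case: ifP.
  apply: ler_sum => i _; rewrite /node /weight /=.
  have := norm_weight_le m i y12.
  have : 1 <= i.+1%:R ^+ 2 :> R by rewrite -natrX ler1n expn_gt0.
  have : i.+1%:R ^+ 2 <= m%:R ^+ 2 :> R by rewrite lerXn2r ?nnegrE ?ler0n// ler_nat.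
  move: (i.+1%:R ^+ 2) => s sm s1 wle.
  apply: (@le_trans _ _ (4 * s^-1 * ((s + y) `^ a) ^+ 2)).
    by rewrite ler_wpM2r ?exprn_ge0 ?powR_ge0.
  have -> : ((s + y) `^ a) ^+ 2 = (s + y) `^ (a * 2).
    by rewrite powRrM powR_mulrn ?powR_ge0.
  rewrite mulrAC ler_pdivrMr; last by lra.
  rewrite /e /moment_exponent; case: ifP => [a12|_] /=.
    have : (s + y) `^ (a * 2) <= s + y.
      by rewrite -[leRHS]powRr1 ?ler_powR//; lra.
    by rewrite expr0; lra.
  have : (s + y) `^ (a * 2) <= (s + y) ^+ 2.
    by rewrite -powR_mulrn ?ler_powR//; lra.
  by nra.
have w1 := norm_weight1_le m y12.
have h0 : `|weight y (ord0 : 'I_m.+2)| * ((node y (ord0 : 'I_m.+2) + y) `^ a) ^+ 2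
    <= y^-1.
  rewrite /weight /node /= normrN ger0_norm ?invr_ge0 ?(ltW y0)// add0r.
  by rewrite ler_piMr ?invr_ge0 ?(ltW y0)// powR_sqr_le1//; lra.
have h1 : `|weight y (lift ord0 ord0 : 'I_m.+2)|
    * ((node y (lift ord0 ord0 : 'I_m.+2) + y) `^ a) ^+ 2 <= y^-1 + 8.
  rewrite (le_trans _ w1)// ler_piMr// powR_sqr_le1// /node /=; lra.
rewrite !big_ord_recl.
have y1 : 0 <= y^-1 by rewrite invr_ge0 ltW.
have : (2 / y + 8) <= (2 / y + 8) * m%:R ^+ e by rewrite ler_peMr//; lra.
by move: tail h0 h1; lra.
Qed.

End WeightBounds.

(** * The two moment-matching priors *)

Section Priors.
Variable R : realType.
Implicit Types (m : nat) (a : R).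

Lemma exists_powR_ge a (b C : R) : a < 1 -> 0 < b ->
  exists2 y : R, 0 < y <= b & C <= y `^ (a - 1).
Proof.
move=> a1 b0; have C0 : 0 < `|C| + 1 by rewrite ltr_wpDl.
have a1' : 0 < 1 - a by rewrite subr_gt0.
pose u := (`|C| + 1)^-1 `^ (1 - a)^-1.
have u0 : 0 < u by apply: powR_gt0; rewrite invr_gt0.
pose y := Num.min b u.
have y0 : 0 < y by rewrite lt_min u0 b0.
exists y; first by rewrite y0 ge_min lexx.
rewrite -[a - 1]opprB powRN.
have : y `^ (1 - a) <= u `^ (1 - a).
  by rewrite ge0_ler_powR ?nnegrE ?(ltW a1') ?(ltW y0) ?(ltW u0)// ge_min lexx orbT.
rewrite /u -powRrM mulVf ?gt_eqF// powRr1 ?invr_ge0 ?(ltW C0)// => yC.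
rewrite (le_trans (ler_norm C))// (@le_trans _ _ (`|C| + 1))// ?lerDl//.
by rewrite -[leLHS]invrK lef_pV2 ?posrE ?invr_gt0 ?powR_gt0.
Qed.

(** The target 9 leaves 1 after the loss of 8 in [weight_gap]. Such a y exists because y^(a-1) is
    unbounded near 0, and it depends on a alone, not on m. *)
Let exists_small_shift a : 0 < a < 1 ->
  exists2 y : R, 0 < y <= 1 / 2 & 9 <= (2 `^ a - 1) * y `^ (a - 1).
Proof.
move=> /andP[a0 a1].
have t0 : 0 < 2 `^ a - 1 :> R.
  have : 0 < a * ln 2 by rewrite mulr_gt0// ln_gt0// ltr1n.
  by rewrite -expR_gt1 subr_gt0 /powR pnatr_eq0.
have [||y y12 yC] := @exists_powR_ge a (1 / 2) (9 / (2 `^ a - 1)) => //.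
by exists y => //; rewrite mulrC -ler_pdivrMr.
Qed.

(** The priors are the parts [pos] and [neg] of the weight divided by their common mass Z. Since 1/y
    <= Z <= 2/y + 16 for every m, the constants s, B and gap are uniform in m. *)
Lemma moment_matching_priors a : 0 < a < 1 ->
  exists s B gap : R, [/\ 0 < s <= 1, 0 < B, 0 < gap &
  forall m, (0 < m)%N ->
  exists mu0 mu1 x : 'I_m.+2 -> R,
  [/\ [/\ forall j, 0 <= mu0 j, forall j, 0 <= mu1 j,
          \sum_j mu0 j = 1, \sum_j mu1 j = 1 &
          forall j, s <= x j <= m%:R ^+ 2 + 1],
      forall l, (l <= m)%N -> \sum_j (mu1 j - mu0 j) * x j ^+ l = 0,
      gap <= \sum_j (mu1 j - mu0 j) * x j `^ a,
      \sum_j mu0 j * (x j `^ a) ^+ 2 <= B * m%:R ^+ moment_exponent a &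
      \sum_j mu1 j * (x j `^ a) ^+ 2 <= B * m%:R ^+ moment_exponent a]].
Proof.
move=> a01; have [y y12 ygap] := exists_small_shift a01.
have /andP[y0 yle] := y12.
have yV : 0 < y^-1 by rewrite invr_gt0.
exists y, (2 / y + 24), (2 / y + 16)^-1; split=> //.
- by rewrite y0; lra.
- by lra.
- by rewrite invr_gt0; lra.
move=> m m_gt0.
pose w (j : 'I_m.+2) := weight y j.
pose pos j := Num.max (w j) 0; pose neg j := Num.max (- w j) 0.
have wE j : w j = pos j - neg j.
  by rewrite /pos /neg; case: (lerP (w j) 0); case: (lerP (- w j) 0); lra.
have pos0 j : 0 <= pos j by rewrite le_max lexx orbT.
have neg0 j : 0 <= neg j by rewrite le_max lexx orbT.
have posw j : pos j <= `|w j| by rewrite ge_max ler_norm normr_ge0.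
have negw j : neg j <= `|w j| by rewrite ge_max -normrN ler_norm normr_ge0.
pose Z := \sum_j neg j.
have ZE : \sum_j pos j = Z.
  apply/eqP; rewrite -subr_eq0 -sumrB; under eq_bigr do rewrite -wE.
  by rewrite sum_weight.
(* The node 0 alone has weight -1/y. *)
have Z_ge : y^-1 <= Z.
  rewrite /Z (bigD1 ord0)//= ler_wpDr ?sumr_ge0//.
  by rewrite /neg /w /weight /= opprK le_max lexx.
have Z_le : Z <= 2 / y + 16.
  by rewrite (le_trans _ (sum_norm_weight_le m y12))// ler_sum.
have Z0 : 0 < Z by apply: lt_le_trans Z_ge.
have ZV1 : Z^-1 <= 1.
  rewrite invf_le1// (le_trans _ Z_ge)// -invf_le1 ?invrK//; lra.
pose x (j : 'I_m.+2) := node y j + y.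
have mu_diff j : pos j / Z - neg j / Z = w j / Z by rewrite wE mulrBl.
exists (fun j => neg j / Z), (fun j => pos j / Z), x.
have moment2 v : (forall j, 0 <= v j <= `|w j|) ->
    \sum_j v j / Z * (x j `^ a) ^+ 2 <= (2 / y + 24) * m%:R ^+ moment_exponent a.
  move=> vw; rewrite (le_trans _ (sum_norm_weight_powR2_le m_gt0 a01 y12))//.
  apply: ler_sum => j _; rewrite ler_wpM2r ?exprn_ge0 ?powR_ge0//.
  have /andP[v0 v1] := vw j; rewrite (le_trans _ v1)// ler_piMr//.
split; [split| | | |].
- by move=> j; rewrite divr_ge0 ?(ltW Z0).
- by move=> j; rewrite divr_ge0 ?(ltW Z0).
- by rewrite -mulr_suml divff ?gt_eqF.
- by rewrite -mulr_suml ZE divff ?gt_eqF.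
- move=> j; rewrite /x /node; have mr : 1 <= m%:R :> R by rewrite ler1n.
  have m2 : 1 <= m%:R ^+ 2 :> R by rewrite expr_ge1//; lra.
  case: j => -[|[|i]] /= im; [lra|lra|].
  have : i.+1%:R ^+ 2 <= m%:R ^+ 2 :> R by rewrite lerXn2r ?nnegrE// ler_nat.
  have : 0 <= i.+1%:R ^+ 2 :> R by rewrite exprn_ge0.
  by move: (i.+1%:R ^+ 2) => z; lra.
- move=> l lm; under eq_bigr do rewrite mu_diff mulrAC.
  rewrite -mulr_suml; set S := \sum_j _.
  suff -> : S = 0 by rewrite mul0r.
  have := @sum_weight_horner R y m (('X + y%:P) ^+ l) m_gt0.
  rewrite -{1}[y%:P]opprK -polyCN size_exp_XsubC ltnS => /(_ _ lm) <-; last by rewrite y0; lra.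
  by apply: eq_bigr => j _; rewrite horner_exp !hornerE.
- under eq_bigr do rewrite mu_diff mulrAC.
  rewrite -mulr_suml ler_pdivlMr//.
  have : 1 <= \sum_j w j * x j `^ a.
    by rewrite (le_trans _ (weight_gap m a01 y12))//; lra.
  apply: le_trans; rewrite mulrC ler_pdivrMr ?mul1r//; lra.
- by apply: moment2 => j; rewrite neg0 negw.
- by apply: moment2 => j; rewrite pos0 posw.
Qed.

End Priors.

(** * Decomposition of phi into a power and a Lipschitz function *)

Section PowerPlusLipschitz.
Variable R : realType.
Implicit Types f df : R -> R.

Lemma is_derive_I01 f df (x : R) : deriv_on_I01 R f df -> 0 < x < 1 ->
  is_derive x 1 f (df x).
Proof.
move=> fdf /andP[x0 x1]; have x01 : 0 < x <= 1 by rewrite x0 ltW.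
suff L : (fun h => h^-1 *: ((f \o shift x) (h *: (1 : R)) - f x)) @ 0^' --> df x.
  by split; [apply/cvg_ex; exists (df x)|exact: cvg_lim L].
apply/cvgrPdist_lt => e e0.
move: (fdf x x01) => /cvgrPdist_lt /(_ _ e0) /nbhs_ballP[d /= d0 dP].
(* This radius keeps x + h inside (0, 1), where the limit within (0, 1] is two-sided. *)
pose r := Num.min d (Num.min x (1 - x)).
have r0 : 0 < r by rewrite !lt_min d0 x0 subr_gt0 x1.
apply/nbhs_ballP; exists r => //= h; rewrite /ball/= sub0r normrN => hr h0.
move: hr; rewrite !lt_min => /and3P[hd hx hx1].
have := dP (h + x).
rewrite /ball /= opprD addrCA subrr addr0 normrN => /(_ hd).
have [h1 h2] : h <= `|h| /\ - h <= `|h| by rewrite -{2}normrN !ler_norm.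
have hx0 : h + x != x by rewrite -subr_eq0 addrK.
have hxI : 0 < h + x <= 1 by move: h1 h2 hx hx1; move: `|h| => u; lra.
move=> /(_ (conj hxI hx0)).
by rewrite addrK [_ *: 1]mulr1 /= mulrC.
Qed.

Lemma is_derive_lipschitz f df M :
  (forall x : R, 0 < x < 1 -> is_derive x 1 f (df x)) ->
  (forall x : R, 0 < x < 1 -> `|df x| <= M) ->
  forall p q : R, 0 < p < 1 -> 0 < q < 1 -> `|f p - f q| <= M * `|p - q|.
Proof.
move=> fdf dfM.
suff H (p q : R) : 0 < p < 1 -> 0 < q < 1 -> q <= p -> `|f p - f q| <= M * `|p - q|.
  move=> p q p01 q01; have [qp|pq] := leP q p; first exact: H.
  by rewrite distrC [`|p - q|]distrC H// ltW.
move=> p01 q01 qp.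
have inI x : x \in `[q, p] -> 0 < x < 1.
  by rewrite in_itv /= => /andP[qx xp]; move: p01 q01; lra.
have [||c cqp ->] := @MVT_segment _ f df q p qp.
- by move=> x xI; apply/fdf/inI; exact: subset_itv_oo_cc.
- apply: derivable_within_continuous => x xI.
  by have [] := fdf _ (inI _ xI).
by rewrite normrM ler_wpM2r// dfM// inI.
Qed.

(** By the intermediate value theorem. For phi'' near 0 it converts the growth condition, which only
    concerns the absolute value, into an asymptotic formula with a fixed sign. *)
Lemma constant_sign f (e : R) : e <= 1 -> {within I01 R, continuous f} ->
  (forall x, 0 < x < e -> f x != 0) ->
  forall x y, 0 < x < e -> 0 < y < e -> 0 < f x * f y.
Proof.
move=> e1 fcont fne0.
suff H x y : 0 < x < e -> 0 < y < e -> x <= y -> 0 < f x * f y.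
  move=> x y xe ye; have [xy|yx] := leP x y; first exact: H.
  by rewrite mulrC H// ltW.
move=> xe ye xy; rewrite ltNge; apply/negP => fxy.
have cont : {within `[x, y], continuous f}.
  apply: continuous_subspaceW fcont => z /=.
  by rewrite in_itv /I01 /= => /andP[xz zy]; move: xe ye; lra.
have [|c] := @IVT _ f x y 0 xy cont.
  rewrite ge_min le_max; move: fxy.
  by have [|] := leP (f x) 0; have [|] := leP (f y) 0; nra.
rewrite in_itv /= => /andP[xc cy] fc0.
have /fne0 : 0 < c < e by move: xe ye; lra.
by rewrite fc0 eqxx.
Qed.

(** Let sigma be the sign of phi'' near 0. Then phi'' - sigma D p^(alpha-2) is bounded on (0, 1). By
    the mean value theorem phi' - A alpha p^(alpha-1) is Lipschitz, hence bounded, and a second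
    application makes phi - A p^alpha Lipschitz. *)
Lemma power_plus_lipschitz (alpha : R) (phi phi1 phi2 : R -> R) :
  0 < alpha < 1 -> C2_on_I01 R phi phi1 phi2 ->
  (exists W c c' : R, 0 < W /\
     forall p, 0 < p <= 1 ->
       (2 - alpha) * W * p `^ (alpha - 2) + c' <= `|phi2 p|
       /\ `|phi2 p| <= (2 - alpha) * W * p `^ (alpha - 2) + c) ->
  exists A L : R, [/\ A != 0, 0 <= L & forall p q, 0 < p < 1 -> 0 < q < 1 ->
    `|(phi p - A * p `^ alpha) - (phi q - A * q `^ alpha)| <= L * `|p - q|].
Proof.
move=> /andP[a0 a1] [d1 [d2 [c1 c2]]] [W [c [c' [W0 bnd]]]].
pose D := (2 - alpha) * W.
have D0 : 0 < D by rewrite mulr_gt0//; lra.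
have cc : 0 < `|c'| + 1 by rewrite ltr_wpDl.
(* Below e one has D p^(alpha-2) >= D / p > |c'| + 1, so the lower bound on |phi''| is positive. *)
pose e := Num.min 1 (D / (`|c'| + 1)).
have e0 : 0 < e by rewrite lt_min ltr01 divr_gt0.
have e1 : e <= 1 by rewrite ge_min lexx.
have pos2 p : 0 < p < e -> 0 < `|phi2 p|.
  move=> /andP[p0 pe].
  have p1 : p < 1 by apply: lt_le_trans e1.
  have [lb _] := bnd p (introT andP (conj p0 (ltW p1))).
  apply: lt_le_trans lb; rewrite -/D.
  have : p^-1 <= p `^ (alpha - 2).
    by rewrite -powR_inv1 ?(ltW p0)// ger_powR ?p0 ?(ltW p1)//; lra.
  rewrite -(ler_pM2l D0).
  have : `|c'| + 1 < D * p^-1.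
    rewrite ltr_pdivlMr// mulrC -ltr_pdivlMr//.
    by rewrite (lt_le_trans pe)// ge_min lexx orbT.
  by have := ler_norm (- c'); rewrite normrN; move: (p `^ _) (p^-1) => u v; lra.
have sgn := @constant_sign phi2 e e1 c2 (fun x xe => negbT (introF eqP (fun H =>
  elimF eqP (gt_eqF (pos2 x xe)) (eq_trans (congr1 Num.norm H) (normr0 _))))).
pose h := e / 2.
have he : 0 < h < e by rewrite /h; lra.
pose sigma := Num.sg (phi2 h).
have sigma2 : sigma * sigma = 1.
  rewrite /sigma -sgrM gtr0_sg//; exact: sgn.
have phi2E p : 0 < p < e -> phi2 p = sigma * `|phi2 p|.
  move=> pe; rewrite [LHS]numEsg; congr (_ * _).
  have := gtr0_sg (sgn _ _ pe he); rewrite sgrM -/sigma => H.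
  by rewrite -[LHS]mulr1 -sigma2 mulrA H mul1r.
have nsigma : `|sigma| = 1.
  by rewrite /sigma normr_sg; case: eqP => // H; have := pos2 h he; rewrite H normr0 ltxx.
(* The first two terms serve p < e, where the main terms cancel; for p >= e both main terms are at
   most D e^(alpha-2). *)
pose M := `|c| + `|c'| + 2 * (D * e `^ (alpha - 2)).
have g2M (p : R) : 0 < p < 1 -> `|phi2 p - sigma * D * p `^ (alpha - 2)| <= M.
  move=> /andP[p0 p1].
  have [lb ub] := bnd p (introT andP (conj p0 (ltW p1))).
  have De : 0 <= D * e `^ (alpha - 2) by rewrite mulr_ge0 ?powR_ge0 ?(ltW D0).
  have [pe|ep] := ltP p e.
    rewrite phi2E ?p0// -mulrA -mulrBr normrM nsigma mul1r -/D ler_norml.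
    move: lb ub; rewrite -/D /M.
    have := ler_norm (- c'); have := ler_norm c; rewrite normrN.
    have : 0 <= `|c| by []. have : 0 <= `|c'| by [].
    by move: (D * p `^ _) (D * e `^ _) De => u v; lra.
  rewrite (le_trans (ler_normB _ _))// -mulrA normrM nsigma mul1r.
  rewrite (ger0_norm (mulr_ge0 (ltW D0) (powR_ge0 _ _))).
  have : D * p `^ (alpha - 2) <= D * e `^ (alpha - 2).
    rewrite ler_pM2l// -[alpha - 2]opprB !powRN lef_pV2 ?posrE ?powR_gt0//.
    by rewrite ge0_ler_powR ?nnegrE ?(ltW e0) ?(ltW p0)//; lra.
  move: ub; rewrite -/D /M.
  have := ler_norm c; have : 0 <= `|c'| by [].
  by move: (D * p `^ _) (D * e `^ _) De => u v; lra.
(* Two derivatives of A p^alpha give exactly sigma D p^(alpha-2). *)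
pose A := sigma * D / (alpha * (alpha - 1)).
have Aaa : A * alpha * (alpha - 1) = sigma * D.
  by rewrite /A; field; lra.
pose g1 p := phi1 p - A * alpha * p `^ (alpha - 1).
have g1' (p : R) : 0 < p < 1 -> is_derive p 1 g1 (phi2 p - sigma * D * p `^ (alpha - 2)).
  move=> /andP[p0 p1].
  have H1 : is_derive p 1 phi1 (phi2 p) by apply: is_derive_I01 => //; rewrite p0.
  have H2 := is_derive1_powR (alpha - 1) p0.
  have -> : g1 = phi1 - ((A * alpha) \*: (fun x => x `^ (alpha - 1))) by [].
  apply: is_derive_eq; rewrite -Aaa /=.
  have -> : alpha - 2 = alpha - 1 - 1 by ring.
  by rewrite /GRing.scale /= !mulrA.
have g1L (p q : R) : 0 < p < 1 -> 0 < q < 1 -> `|g1 p - g1 q| <= M * `|p - q|.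
  exact: is_derive_lipschitz g1' g2M p q.
have M0 : 0 <= M.
  by apply: le_trans (g2M (1 / 2) _); rewrite ?normr_ge0//; lra.
pose L := `|g1 (1 / 2)| + M.
exists A, L; split; last first.
- apply: (@is_derive_lipschitz (fun p => phi p - A * p `^ alpha) g1) => p p01.
    have H1 : is_derive p 1 phi (phi1 p) by apply: is_derive_I01.
    have /andP[p0 p1] := p01; have H2 := is_derive1_powR alpha p0.
    have -> : (fun p => phi p - A * p `^ alpha) = phi - (A \*: (fun x => x `^ alpha)) by [].
    by apply: is_derive_eq; rewrite /g1 /GRing.scale /= mulrA.
  have h01 : 0 < (1 / 2 : R) < 1 by lra.
  rewrite -[g1 p](subrK (g1 (1 / 2))) (le_trans (ler_normD _ _))// addrC lerD2l.
  rewrite (le_trans (g1L _ _ p01 h01))// ler_piMr//.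
  by rewrite ler_norml; move: p01; lra.
- by rewrite addr_ge0.
- apply/eqP => A0; have := congr1 Num.norm Aaa.
  by rewrite A0 !mul0r normr0 normrM nsigma mul1r gtr0_norm// => H; move: D0; rewrite -H ltxx.
Qed.

Lemma powR_increment (a p q : R) : 0 < p -> p <= q ->
  exists2 c, p <= c <= q & q `^ a - p `^ a = a * c `^ (a - 1) * (q - p).
Proof.
move=> p0 pq.
have der x : x \in `[p, q] -> is_derive x 1 (fun x => x `^ a) (a * x `^ (a - 1)).
  by rewrite in_itv /= => /andP[px _]; apply: is_derive1_powR; apply: lt_le_trans px.
have cont : {within `[p, q], continuous (fun x => x `^ a)}.
  by apply: derivable_within_continuous => x /der[].
have der' x : x \in `]p, q[ -> is_derive x 1 (fun x => x `^ a) (a * x `^ (a - 1)).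
  by move=> /subset_itv_oo_cc; exact: der.
have [c cpq E] := MVT_segment pq der' cont.
by exists c => //; rewrite in_itv in cpq.
Qed.

Lemma powR_lipschitz (a b p q : R) : 0 <= a <= 1 -> 0 < b -> b <= p -> b <= q ->
  `|p `^ a - q `^ a| <= a * b `^ (a - 1) * `|p - q|.
Proof.
move=> /andP[a0 a1] b0.
suff H u v : b <= u -> u <= v -> `|v `^ a - u `^ a| <= a * b `^ (a - 1) * `|v - u|.
  move=> bp bq; have [pq|qp] := leP p q; last by apply: H => //; exact: ltW.
  by rewrite distrC [`|p - q|]distrC H.
move=> bu uv; have u0 : 0 < u by apply: lt_le_trans bu.
have [c /andP[uc cv] ->] := powR_increment a u0 uv.
have c0 : 0 < c by apply: lt_le_trans uc.
rewrite normrM ler_wpM2r// ger0_norm ?mulr_ge0 ?powR_ge0// ler_wpM2l//.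
rewrite -[a - 1]opprB !powRN lef_pV2 ?posrE ?powR_gt0//.
by rewrite ge0_ler_powR ?nnegrE ?subr_ge0 ?(ltW b0) ?(ltW c0)// (le_trans bu).
Qed.

Lemma powR_increment_ge (a p q : R) : 0 <= a <= 1 -> 0 < p -> p <= q ->
  a * q `^ (a - 1) * (q - p) <= q `^ a - p `^ a.
Proof.
move=> /andP[a0 a1] p0 pq; have [c /andP[pc cq] ->] := powR_increment a p0 pq.
have c0 : 0 < c by apply: lt_le_trans pc.
have q0 : 0 < q by apply: lt_le_trans cq.
rewrite ler_wpM2r ?subr_ge0// ler_wpM2l//.
rewrite -[a - 1]opprB !powRN lef_pV2 ?posrE ?powR_gt0//.
by rewrite ge0_ler_powR ?nnegrE ?subr_ge0 ?(ltW q0) ?(ltW c0).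
Qed.

(** Meant for the last coordinate, which absorbs the remaining mass and stays above a fixed b. *)
Lemma lipschitz_away_from_0 (alpha A L : R) (phi : R -> R) (b : R) :
  0 < alpha < 1 -> 0 < b ->
  (forall p q, 0 < p < 1 -> 0 < q < 1 ->
    `|(phi p - A * p `^ alpha) - (phi q - A * q `^ alpha)| <= L * `|p - q|) ->
  forall p q, b <= p < 1 -> b <= q < 1 ->
    `|phi p - phi q| <= (`|A| * (alpha * b `^ (alpha - 1)) + L) * `|p - q|.
Proof.
move=> /andP[a0 a1] b0 H p q /andP[bp p1] /andP[bq q1].
have -> : phi p - phi q = A * (p `^ alpha - q `^ alpha)
   + ((phi p - A * p `^ alpha) - (phi q - A * q `^ alpha)) by ring.
rewrite (le_trans (ler_normD _ _))// mulrDl lerD//.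
  by rewrite normrM -mulrA ler_wpM2l// powR_lipschitz// !ltW.
by rewrite H// ?p1 ?q1 andbT (lt_le_trans b0).
Qed.

End PowerPlusLipschitz.

(** * Le Cam's two-point and mixture bounds *)

Section LeCam.
Variable R : realType.
Implicit Types (n k : nat).

Lemma minimax_risk_ge n k phi (v : R) :
  (forall est w, (forall P, simplex R k P -> risk R n k phi est P <= w) -> v <= w) ->
  (v%:E <= minimax_risk R n k phi)%E.
Proof.
move=> H; apply: le_ereal_inf_tmp => _ [est _ <-].
have ub P : simplex R k P -> ((risk R n k phi est P)%:E
    <= ereal_sup [set (risk R n k phi est P)%:E | P in simplex R k])%E.
  by move=> simP; apply: ereal_sup_ubound; exists P.
case: (ereal_sup _) ub => [w||] ub; rewrite ?leey//.
  by rewrite lee_fin; apply: (H est) => P /ub; rewrite lee_fin.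
(* A supremum equal to minus infinity would make every real w an upper bound of the risk. *)
have : v <= v - 1 by apply: (H est) => P /ub.
by rewrite leNgt ltrBlDr ltrDl ltr01.
Qed.

(** At each i the two terms sum to at least min(M0, M1) (T1 - T0)^2 / 2. As 2 min(M0, M1) = M0 + M1
    - |M1 - M0|, the minima have total mass at least 1/2. *)
Lemma lecam_two_measures (I : finType) (Q : pred I) (M0 M1 est : I -> R) T0 T1 :
  (forall i, 0 <= M0 i) -> (forall i, 0 <= M1 i) ->
  \sum_(i | Q i) M0 i = 1 -> \sum_(i | Q i) M1 i = 1 ->
  \sum_(i | Q i) `|M1 i - M0 i| <= 1 ->
  (T1 - T0) ^+ 2 / 4 <= \sum_(i | Q i) M0 i * (est i - T0) ^+ 2
                      + \sum_(i | Q i) M1 i * (est i - T1) ^+ 2.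
Proof.
move=> M0_ge0 M1_ge0 S0 S1 TV.
pose D := (T1 - T0) ^+ 2 / 4.
have D0 : 0 <= D by rewrite divr_ge0 ?sqr_ge0.
rewrite -big_split /=.
apply: (@le_trans _ _ (\sum_(i | Q i) D * (M0 i + M1 i - `|M1 i - M0 i|))).
  by rewrite -mulr_sumr sumrB big_split/= S0 S1 ler_peMr//; move: TV; lra.
apply: ler_sum => i _; rewrite /D.
have [M01|M01] := ger0P (M1 i - M0 i).
  have : 0 <= (M1 i - M0 i) * (est i - T1) ^+ 2 by rewrite mulr_ge0 ?sqr_ge0.
  have : 0 <= M0 i * ((est i - T0) + (est i - T1)) ^+ 2.
    by rewrite mulr_ge0 ?sqr_ge0.
  by move: (M0 i) (M1 i) (est i) => a b c; nra.
have : 0 <= (M0 i - M1 i) * (est i - T0) ^+ 2 by rewrite mulr_ge0 ?sqr_ge0; lra.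
have : 0 <= M1 i * ((est i - T0) + (est i - T1)) ^+ 2 by rewrite mulr_ge0 ?sqr_ge0.
by move: (M0 i) (M1 i) (est i) => a b c; nra.
Qed.

Lemma minimax_risk_two_points n k phi (P0 P1 : 'I_k -> R) :
  simplex R k P0 -> simplex R k P1 ->
  \sum_(N : histo n k | is_histo n k N)
    `|multinom_pmf R n k P1 N - multinom_pmf R n k P0 N| <= 1 ->
  (((theta R k phi P1 - theta R k phi P0) ^+ 2 / 8)%:E <= minimax_risk R n k phi)%E.
Proof.
move=> [P0_ge0 P0_1] [P1_ge0 P1_1] TV; apply: minimax_risk_ge => est w H.
have := @lecam_two_measures _ (is_histo n k) (multinom_pmf R n k P0)
  (multinom_pmf R n k P1) est (theta R k phi P0) (theta R k phi P1).
rewrite !sum_multinom_pmf P0_1 P1_1 !expr1n => /(_ _ _ erefl erefl TV) H2.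
have {}H2 := H2 (fun N => multinom_pmf_ge0 N P0_ge0) (fun N => multinom_pmf_ge0 N P1_ge0).
have := H P0 (conj P0_ge0 P0_1); have := H P1 (conj P1_ge0 P1_1).
by rewrite /risk; move: H2; set u := \sum_(N | _) _; set v := \sum_(N | _) _; lra.
Qed.

(** Under a prior theta is random. Its spread about the centre T is paid for by (est - T)^2 <= 2
    (est - theta)^2 + 2 (theta - T)^2, so both averaged errors are at most 2w + 2V and (T1 - T0)^2 /
    4 <= 4w + 4V. *)
Lemma minimax_risk_mixtures n k phi (J : finType) (mu0 mu1 : J -> R) K
    (vec : seq J -> 'I_k -> R) T0 T1 V :
  (forall j, 0 <= mu0 j) -> (forall j, 0 <= mu1 j) ->
  \sum_j mu0 j = 1 -> \sum_j mu1 j = 1 ->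
  (forall s, size s = K -> simplex R k (vec s)) ->
  \sum_(N : histo n k | is_histo n k N)
    `|iexp mu1 K (fun s => multinom_pmf R n k (vec s) N)
      - iexp mu0 K (fun s => multinom_pmf R n k (vec s) N)| <= 1 ->
  iexp mu0 K (fun s => (theta R k phi (vec s) - T0) ^+ 2) <= V ->
  iexp mu1 K (fun s => (theta R k phi (vec s) - T1) ^+ 2) <= V ->
  (((T1 - T0) ^+ 2 / 16 - V)%:E <= minimax_risk R n k phi)%E.
Proof.
move=> mu0_ge0 mu1_ge0 S0 S1 simP TV V0 V1.
apply: minimax_risk_ge => est w H.
pose M (mu : J -> R) (N : histo n k) := iexp mu K (fun s => multinom_pmf R n k (vec s) N).
have M_ge0 mu : (forall j, 0 <= mu j) -> forall N, 0 <= M mu N.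
  move=> mu_ge0 N.
  have <- : iexp mu K (fun=> 0) = 0.
    rewrite -[RHS](mul0r (iexp mu K (fun=> 1))) -iexpZ.
    by apply: eq_iexp => s _; rewrite mul0r.
  apply: le_iexp => // s sK; apply: multinom_pmf_ge0; exact: (simP s sK).1.
have sumM mu : \sum_j mu j = 1 -> \sum_(N : histo n k | is_histo n k N) M mu N = 1.
  move=> S; rewrite /M -iexp_sum -[RHS](iexp_cst S K); apply: eq_iexp => s sK.
  by rewrite sum_multinom_pmf (simP s sK).2 expr1n.
have avg mu T : (forall j, 0 <= mu j) -> \sum_j mu j = 1 ->
    iexp mu K (fun s => (theta R k phi (vec s) - T) ^+ 2) <= V ->
    \sum_(N : histo n k | is_histo n k N) M mu N * (est N - T) ^+ 2 <= 2 * w + 2 * V.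
  move=> mu_ge0 S Vmu.
  have -> : \sum_(N : histo n k | is_histo n k N) M mu N * (est N - T) ^+ 2
      = iexp mu K (fun s => \sum_(N : histo n k | is_histo n k N)
          (est N - T) ^+ 2 * multinom_pmf R n k (vec s) N).
    by rewrite iexp_sum; apply: eq_bigr => N _; rewrite iexpZ mulrC.
  apply: (@le_trans _ _ (iexp mu K (fun s => 2 * w + 2 * (theta R k phi (vec s) - T) ^+ 2))).
    apply: le_iexp => // s sK; have [P_ge0 P1] := simP s sK.
    set t := theta R k phi (vec s).
    apply: (@le_trans _ _ (2 * risk R n k phi est (vec s) + 2 * (t - T) ^+ 2)); last first.
      by rewrite lerD2r ler_pM2l// H.
    have -> : 2 * (t - T) ^+ 2 = \sum_(N : histo n k | is_histo n k N)
        2 * (t - T) ^+ 2 * multinom_pmf R n k (vec s) N.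
      by rewrite -mulr_sumr sum_multinom_pmf P1 expr1n mulr1.
    rewrite /risk mulr_sumr -big_split /=; apply: ler_sum => N _.
    have := mulr_ge0 (multinom_pmf_ge0 N P_ge0) (sqr_ge0 (est N - t - (t - T))).
    rewrite -/t; move: (est N) (multinom_pmf _ _ _ _ _) => u p p0; nra.
  by rewrite iexpD iexp_cst// iexpZ lerD2l ler_pM2l.
have := @lecam_two_measures _ (is_histo n k) (M mu0) (M mu1) est T0 T1.
rewrite !sumM// => /(_ _ _ erefl erefl TV).
move=> /(_ (M_ge0 _ mu0_ge0) (M_ge0 _ mu1_ge0)).
have := avg mu0 T0 mu0_ge0 S0 V0; have := avg mu1 T1 mu1_ge0 S1 V1.
by set u := \sum_(N | _) _; set v := \sum_(N | _) _; lra.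
Qed.

(* |x| <= (M0 + x^2 / M0) / 2 with x = M1 - M0, and M1^2 / M0 is again a
   multinomial term, with parameters P1^2 / P0. *)
Lemma sum_norm_multinom_pmf_sub n k (P0 P1 : 'I_k -> R) :
  (forall i, 0 < P0 i) -> (forall i, 0 <= P1 i) ->
  \sum_i P0 i = 1 -> \sum_i P1 i = 1 ->
  \sum_(N : histo n k | is_histo n k N)
    `|multinom_pmf R n k P1 N - multinom_pmf R n k P0 N|
  <= (\sum_i P1 i ^+ 2 / P0 i) ^+ n / 2.
Proof.
move=> P0_gt0 P1_ge0 S0 S1.
pose M0 := multinom_pmf R n k P0; pose M1 := multinom_pmf R n k P1.
pose M2 := multinom_pmf R n k (fun i => P1 i ^+ 2 / P0 i).
have M0_gt0 N : 0 < M0 N.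
  rewrite /M0 /multinom_pmf mulr_gt0 ?divr_gt0 ?ltr0n ?fact_gt0//.
    by rewrite prodn_gt0// => i; rewrite fact_gt0.
  by apply: prodr_gt0 => i _; rewrite exprn_gt0.
have M2E N : M1 N ^+ 2 = M2 N * M0 N.
  rewrite /M0 /M1 /M2 /multinom_pmf.
  rewrite exprMn [RHS]mulrACA -expr2; congr (_ * _).
  rewrite -big_split -prodrXl; apply: eq_bigr => i _ /=.
  by rewrite -exprMn divfK ?gt_eqF// -!exprM mulnC.
(* The summand is (M0 + (M1 - M0)^2 / M0) / 2 written out; since M0 and M1 have mass 1, only the
   mass of M2 survives. *)
have -> : (\sum_i P1 i ^+ 2 / P0 i) ^+ n / 2
    = \sum_(N : histo n k | is_histo n k N)
        ((M2 N - M1 N) / 2 + (M0 N - M1 N) / 2 + M0 N / 2).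
  rewrite !big_split /= -!mulr_suml !sumrB !sum_multinom_pmf S0 S1 !expr1n.
  by lra.
apply: ler_sum => N _; rewrite -/(M0 N) -/(M1 N).
have := M2E N; have := M0_gt0 N.
move: (M0 N) (M1 N) (M2 N) => u v z u0 zE.
rewrite -(ler_pM2l u0); have := sqr_ge0 (`|v - u| - u).
have := real_normK (num_real (v - u)); move: (`|v - u|) => x xE.
by rewrite sqrrB xE; move: zE; nra.
Qed.

End LeCam.

(** * Probability vectors completed by their last coordinate *)

Section Complete.
Variable R : realType.
Implicit Types (n k : nat) (s t : seq R).

(* Reading past the end of s returns the default value, which is the mass
   missing from s. *)
Definition complete k s : 'I_k -> R := fun i => nth (1 - \sum_(x <- s) x) s i.

Lemma sum_complete K (f : R -> R) s : size s = K ->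
  \sum_(i < K.+1) f (complete s i)
  = \sum_(x <- s) f x + f (1 - \sum_(x <- s) x).
Proof.
move=> sK; rewrite big_ord_recr /= /complete nth_default ?sK//; congr (_ + _).
by rewrite [RHS](big_nth (1 - \sum_(x <- s) x)) big_mkord sK.
Qed.

Lemma simplex_complete K s : size s = K -> (forall x, x \in s -> 0 <= x) ->
  \sum_(x <- s) x <= 1 -> simplex R K.+1 (@complete K.+1 s).
Proof.
move=> sK s0 s1; split; last by rewrite (sum_complete id)// addrC subrK.
move=> i; rewrite /complete; have [iK|Ki] := ltnP i (size s).
  by rewrite s0// mem_nth.
by rewrite nth_default// subr_ge0.
Qed.

(** Changing one entry x affects only its own coordinate and the last, so the one-coordinate
    exchange bound applies. At all other indices [nth] stays inside the sequence and its default
    does not matter. *)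
Lemma complete_cat_cons K s t x (lt_sK : (size s < K.+1)%N) :
  (size s + size t).+1 = K ->
  @complete K.+1 (s ++ x :: t) =
  swap2 (@complete K.+1 (s ++ 0 :: t)) (Ordinal lt_sK) ord_max
    x (1 - \sum_(y <- s) y - \sum_(y <- t) y - x).
Proof.
move=> sK; apply/funext => i; rewrite /swap2 /complete.
rewrite -!val_eqE /= !big_cat /= !big_cons !nth_cat.
case: ltngtP => [is_|si|->] /=.
- have -> : (val i == K) = false by apply/eqP; move: is_ sK => /=; lia.
  by apply: set_nth_default.
- rewrite -[val i]/(i : nat); have [iK|iK] := eqVneq (i : nat) K.
    by rewrite nth_default /=; [ring|lia].
  have : (i < K)%N by move: (ltn_ord i) iK; lia.
  case E : (i - size s)%N => [|j] /=; first by move: E si; lia.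
  by move=> iltK; apply: set_nth_default; lia.
- by rewrite subnn.
Qed.

(** The two affected coordinates share the mass q and the others hold 1 - q, so the base of the n-th
    power is 1 + 2 r X whatever s and t are. *)
Lemma sum_norm_mixed_complete_le n K s t (J : finType) (w x : J -> R) m X r :
  (size s + size t).+1 = K ->
  (forall y, y \in s ++ t -> 0 <= y) -> \sum_(y <- s) y + \sum_(y <- t) y <= 1 ->
  0 <= X -> (forall l, (l <= m)%N -> \sum_j w j * x j ^+ l = 0) ->
  (forall j, 0 <= x j <= X) -> 1 <= r ->
  \sum_(N : histo n K.+1 | is_histo n K.+1 N)
     `|\sum_j w j * multinom_pmf R n K.+1 (@complete K.+1 (s ++ x j :: t)) N|
  <= (\sum_j `|w j|) / r ^+ m.+1 * (1 + 2 * (r * X)) ^+ n.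
Proof.
move=> sK st0 st1 X0 mom xX r1.
have lt_sK : (size s < K.+1)%N by lia.
set q := 1 - \sum_(y <- s) y - \sum_(y <- t) y.
pose p := @complete K.+1 (s ++ 0 :: t).
have szK : size (s ++ 0 :: t) = K by rewrite size_cat /= addnS.
have [p0 p1] : simplex R K.+1 p.
  apply: simplex_complete => //.
    by move=> y; rewrite mem_cat inE orbCA => /orP[/eqP->//|]; rewrite -mem_cat; exact: st0.
  by rewrite big_cat big_cons /= add0r.
have ne : Ordinal lt_sK != ord_max by rewrite -val_eqE /=; apply/eqP; lia.
have q0 : 0 <= q by rewrite /q; move: st1; lra.
have := @sum_norm_mixed_pmf_le R n K.+1 p _ _ q J w x m X r ne p0 q0 X0 mom xX r1.
have -> : \sum_(i < K.+1 | (i != Ordinal lt_sK) && (i != ord_max)) p i + q = 1.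
  rewrite -p1 [RHS](bigD1 (Ordinal lt_sK))//= [X in _ = _ + X](bigD1 ord_max) 1?eq_sym//=.
  have -> : p (Ordinal lt_sK) = 0 by rewrite /p /complete nth_cat /= ltnn subnn.
  have -> : p ord_max = q.
    by rewrite /p /complete nth_default ?szK//= big_cat big_cons /= /q; ring.
  by rewrite add0r addrC.
apply: le_trans; apply: ler_sum => N _.
by under eq_bigr do rewrite (complete_cat_cons _ lt_sK)//.
Qed.

End Complete.

(** * The mixture lower bound with free parameters *)

Section PriorBound.
Variable R : realType.

(** X bounds the largest coordinate a (m^2 + 1). The conditions then say in turn: the last
    coordinate stays above 1/2; K exchanges cost at most 1 in total variation; the Lipschitz error K
    X is small against the separation K a^alpha; so is the standard deviation, of order a^alpha
    times the root of K m^e with e = [moment_exponent alpha]. *)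
Lemma prior_bound (alpha A L : R) (phi : R -> R) :
  0 < alpha < 1 -> A != 0 -> 0 <= L ->
  (forall p q, 0 < p < 1 -> 0 < q < 1 ->
    `|(phi p - A * p `^ alpha) - (phi q - A * q `^ alpha)| <= L * `|p - q|) ->
  exists B c eta : R, [/\ 0 < B, 0 < c, 0 < eta &
  forall (n m K : nat) (a r X : R), (0 < m)%N -> 0 < a -> 1 <= r ->
    X = 2 * a * m%:R ^+ 2 ->
    K%:R * X <= 1 / 2 ->
    K%:R * (2 / r ^+ m.+1 * (1 + 2 * (r * X)) ^+ n) <= 1 ->
    X <= eta * a `^ alpha ->
    B * m%:R ^+ moment_exponent alpha <= K%:R ->
    ((c * (K%:R * a `^ alpha) ^+ 2)%:E <= minimax_risk R n K.+1 phi)%E].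
Proof.
move=> al01 A0 L0 dec.
have [s0 [B0 [gap [/andP[s0_gt0 s0_le1] B0_gt0 gap0 priors]]]] :=
  moment_matching_priors al01.
pose L3 := `|A| * (alpha * (1 / 2) `^ (alpha - 1)) + L + L + 1.
have L2_ge0 : 0 <= `|A| * (alpha * (1 / 2) `^ (alpha - 1)).
  by rewrite !mulr_ge0 ?powR_ge0//; case/andP: al01 => /ltW.
have L3_gt0 : 0 < L3 by rewrite /L3; lra.
have nA : 0 < `|A| by rewrite normr_gt0.
(* In units of (A gap K a^alpha)^2 the fluctuation costs 1/64 and the Lipschitz error 1/128,
   together below 1/32. The separation contributes 1/16, which leaves c. *)
exists (128 * B0 / gap ^+ 2), (A ^+ 2 * gap ^+ 2 / 32), (`|A| * gap / (16 * L3)).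
split.
- by rewrite divr_gt0 ?exprn_gt0//; lra.
- by rewrite divr_gt0// mulr_gt0//; [rewrite exprn_even_gt0|rewrite exprn_gt0].
- by rewrite divr_gt0 ?mulr_gt0//; lra.
move=> n m K a r X m_gt0 a0 r1 XE hK hTV hX hB.
have [mu0 [mu1 [x [[mu0_ge0 mu1_ge0 S0 S1 xb] mom gapE m20 m21]]]] := priors m m_gt0.
set b := a `^ alpha in hX *.
have b0 : 0 < b by apply: powR_gt0.
have mr : 1 <= m%:R :> R by rewrite ler1n.
have m2 : 1 <= m%:R ^+ 2 :> R by rewrite expr_ge1//; lra.
have X0 : 0 < X by rewrite XE !mulr_gt0//; lra.
have K_gt0 : 0 < K%:R :> R.
  apply: lt_le_trans hB; rewrite mulr_gt0 ?exprn_gt0//; last by lra.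
  by rewrite divr_gt0 ?exprn_gt0//; lra.
have K1 : 1 <= K%:R :> R by move: K_gt0; rewrite ltr0n ler1n.
have X12 : X <= 1 / 2 by apply: le_trans hK; rewrite ler_peMl// ltW.
pose p j := a * x j.
have p0 j : 0 < p j.
  by rewrite mulr_gt0//; apply: lt_le_trans s0_gt0 _; case/andP: (xb j).
have pX j : p j <= X.
  have /andP[_ xj] := xb j.
  by rewrite XE [2 * a]mulrC -mulrA ler_pM2l//; move: m2 xj; move: (m%:R ^+ 2) => z; lra.
have sum_p (s : seq 'I_m.+2) : \sum_(j <- s) p j <= (size s)%:R * X.
  elim: s => [|j s IHs]; first by rewrite big_nil mul0r.
  by rewrite big_cons /= -natr1 mulrDl mul1r addrC lerD.
have sum_p_gt0 (s : seq 'I_m.+2) : 0 <= \sum_(j <- s) p j.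
  by rewrite sumr_ge0// => j _; exact: ltW.
pose vec (s : seq 'I_m.+2) := @complete R K.+1 (map p s).
pose psi q := phi q - A * q `^ alpha.
(* The Lipschitz part is frozen at X and the last coordinate at 1 - K X, so the centres of the two
   priors differ only in the alpha-th moment. *)
pose T mu := K%:R * psi X + phi (1 - K%:R * X)
  + A * b * (K%:R * \sum_j mu j * x j `^ alpha).
have thetaE mu s : size s = K ->
    `|theta R K.+1 phi (vec s) - T mu
      - A * b * \sum_(j <- s) (x j `^ alpha - \sum_j mu j * x j `^ alpha)|
    <= L3 * (K%:R * X).
  move=> sK; set E := \sum_j _.
  have -> : theta R K.+1 phi (vec s)
      = \sum_(j <- s) phi (p j) + phi (1 - \sum_(j <- s) p j).
    by rewrite /theta sum_complete ?size_map// !big_map.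
  have -> : \sum_(j <- s) (x j `^ alpha - E)
      = \sum_(j <- s) x j `^ alpha - K%:R * E.
    by rewrite sumrB big_const_seq count_predT sK iter_addr_0 mulr_natl.
  have -> : \sum_(j <- s) phi (p j) = A * b * (\sum_(j <- s) x j `^ alpha)
      + K%:R * psi X + \sum_(j <- s) (psi (p j) - psi X).
    rewrite sumrB [\sum_(i <- s) psi X]big_const_seq count_predT sK iter_addr_0.
    have cancel2 (u v w : R) : u + v + (w - v) = u + w by ring.
    rewrite -[psi X *+ K]mulr_natl cancel2 mulr_sumr -big_split /=.
    apply: eq_bigr => j _; rewrite /psi /p powRM ?(ltW a0)//; last first.
      by case/andP: (xb j) => sx _; apply: le_trans sx; exact: ltW.
    by rewrite -/b; ring.
  rewrite /T -/E; set u := \sum_(j <- s) x j `^ alpha.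
  set w := \sum_(j <- s) (_ - _); set z := phi _; set y := phi _.
  have -> : A * b * u + K%:R * psi X + w + z
      - (K%:R * psi X + y + A * b * (K%:R * E)) - A * b * (u - K%:R * E)
      = w + (z - y) by ring.
  rewrite (le_trans (ler_normD _ _))//.
  have H1 : `|\sum_(j <- s) (psi (p j) - psi X)| <= L * (K%:R * X).
    rewrite -sK mulrCA; elim: (s) => [|j s' IHs].
      by rewrite big_nil normr0 mul0r.
    rewrite big_cons /= -natr1 mulrDl mul1r addrC (le_trans (ler_normD _ _))// lerD//.
    have pj01 : 0 < p j < 1 by rewrite p0 (le_lt_trans (pX j))//; lra.
    have X01 : 0 < X < 1 by rewrite X0; lra.
    rewrite (le_trans (dec _ _ pj01 X01))// ler_wpM2l// distrC.
    by rewrite ger0_norm ?subr_ge0// gerBl; exact: ltW.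
  have H2 : `|phi (1 - \sum_(j <- s) p j) - phi (1 - K%:R * X)|
      <= (`|A| * (alpha * (1 / 2) `^ (alpha - 1)) + L) * (K%:R * X).
    have := sum_p s; have := sum_p_gt0 s; rewrite sK => s1 s2.
    (* At least one draw is needed to put the last coordinate strictly below 1, where the Lipschitz
       bound is available. *)
    have [j [s' sE]] : exists j s', s = j :: s'.
      by case: (s) sK K_gt0 => [<-|j s' _ _]; [rewrite ltxx|exists j, s'].
    have s3 : 0 < \sum_(j <- s) p j by rewrite sE big_cons ltr_pwDl.
    have KX0 : 0 < K%:R * X by rewrite mulr_gt0.
    have p12 : 1 / 2 <= 1 - \sum_(j <- s) p j < 1 by move: hK s2 s3; lra.
    have X12' : 1 / 2 <= 1 - K%:R * X < 1 by move: hK; lra.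
    have half_gt0 : 0 < 1 / 2 :> R by lra.
    rewrite (le_trans (lipschitz_away_from_0 al01 half_gt0 dec p12 X12'))//.
    by rewrite ler_wpM2l ?addr_ge0// ler_norml; move: s1 s2 hK; lra.
  have KX0 := mulr_ge0 (ltW K_gt0) (ltW X0).
  by rewrite (le_trans (lerD H1 H2))// -mulrDl ler_wpM2r// /L3; lra.
have varT mu : (forall j, 0 <= mu j) -> \sum_j mu j = 1 ->
    \sum_j mu j * (x j `^ alpha) ^+ 2 <= B0 * m%:R ^+ moment_exponent alpha ->
    iexp mu K (fun s => (theta R K.+1 phi (vec s) - T mu) ^+ 2)
    <= A ^+ 2 * gap ^+ 2 / 32 * (K%:R * b) ^+ 2.
  move=> mu_ge0 S mom2; set E := \sum_j mu j * x j `^ alpha.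
  pose h := `|A| * gap / 16 * (K%:R * b).
  have hge : L3 * (K%:R * X) <= h.
    rewrite mulrCA /h [leRHS]mulrCA ler_pM2l//.
    apply: (@le_trans _ _ (L3 * (`|A| * gap / (16 * L3) * b))); first by rewrite ler_pM2l.
    by rewrite le_eqVlt; apply/orP; left; apply/eqP; field; lra.
  apply: (@le_trans _ _ (iexp mu K (fun s => 2 * (A * b) ^+ 2 *
      (\sum_(j <- s) (x j `^ alpha - E)) ^+ 2 + 2 * h ^+ 2))).
    apply: le_iexp => // s sK.
    have := le_trans (thetaE mu s sK) hge; rewrite -/E.
    move: (\sum_(j <- s) _) (theta _ _ _ _ - T mu) => u t tu.
    have : (t - A * b * u) ^+ 2 <= h ^+ 2.
      by rewrite -ler_sqrt ?sqr_ge0// !sqrtr_sqr [`|h|]ger0_norm// (le_trans _ tu).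
    by have := sqr_ge0 (A * b * u - (t - A * b * u)); nra.
  rewrite iexpD iexpZ iexp_cst// iexp_variance//.
  set V := \sum_j _.
  have VB : V <= B0 * m%:R ^+ moment_exponent alpha.
    by apply: le_trans mom2; exact: variance_le_moment2.
  have KB : B0 * m%:R ^+ moment_exponent alpha <= K%:R * gap ^+ 2 / 128.
    have g2 : 0 < gap ^+ 2 by rewrite exprn_gt0.
    rewrite ler_pdivlMr// -ler_pdivrMr//; apply: le_trans hB.
    by rewrite le_eqVlt; apply/orP; left; apply/eqP; field; lra.
  have KVb : 2 * (A * b) ^+ 2 * (K%:R * V)
      <= 2 * (A * b) ^+ 2 * (K%:R * (K%:R * gap ^+ 2 / 128)).
    apply: ler_wpM2l; first by rewrite mulr_ge0 ?sqr_ge0.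
    by apply: ler_wpM2l; [exact: ltW|exact: le_trans VB KB].
  apply: le_trans (lerD KVb (lexx _)) _.
  have -> : h ^+ 2 = A ^+ 2 * gap ^+ 2 / 256 * (K%:R * b) ^+ 2.
    by rewrite /h !exprMn real_normK ?num_real//; field.
  have : 0 <= A ^+ 2 * gap ^+ 2 * (K%:R * b) ^+ 2 by rewrite -!exprMn sqr_ge0.
  by lra.
have TV : \sum_(N : histo n K.+1 | is_histo n K.+1 N)
    `|iexp mu1 K (fun s => multinom_pmf R n K.+1 (vec s) N)
      - iexp mu0 K (fun s => multinom_pmf R n K.+1 (vec s) N)| <= 1.
  apply: le_trans hTV.
  apply: (sum_norm_iexp_sub (G := fun N s => multinom_pmf R n K.+1 (vec s) N)) => // s t st.
  have W2 : \sum_j `|mu1 j - mu0 j| <= 2.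
    apply: (@le_trans _ _ (\sum_j (mu1 j + mu0 j))).
      by apply: ler_sum => j _; rewrite (le_trans (ler_normB _ _))// !ger0_norm.
    by rewrite big_split /= S0 S1.
  have r0 : 0 < r by lra.
  have mom' l : (l <= m)%N -> \sum_j (mu1 j - mu0 j) * p j ^+ l = 0.
    move=> lm; rewrite -[RHS](mulr0 (a ^+ l)) -[in RHS](mom l lm) mulr_sumr.
    by apply: eq_bigr => j _; rewrite /p exprMn mulrCA.
  have szK : (size (map p s) + size (map p t)).+1 = K by rewrite !size_map.
  have pos y : y \in map p s ++ map p t -> 0 <= y.
    by rewrite -map_cat => /mapP[j _ ->]; exact: ltW.
  have sum1 : \sum_(y <- map p s) y + \sum_(y <- map p t) y <= 1.
    rewrite !big_map (le_trans (lerD (sum_p s) (sum_p t)))// -mulrDl -natrD.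
    have : (size s + size t)%:R * X <= K%:R * X by rewrite ler_pM2r// ler_nat -st.
    by move: hK; lra.
  have pX' j : 0 <= p j <= X by rewrite pX ltW.
  have := @sum_norm_mixed_complete_le R n K _ _ _ (fun j => mu1 j - mu0 j) p m X r
    szK pos sum1 (ltW X0) mom' pX' r1.
  rewrite /vec; under eq_bigr => N _ do under eq_bigr => j _ do rewrite -[p j :: _]/(map p (j :: t)) -map_cat.
  move/le_trans; apply.
  rewrite ler_wpM2r ?exprn_ge0//; last by rewrite ler_wpM2r// invr_ge0 exprn_ge0// ltW.
  by rewrite addr_ge0// !mulr_ge0// ltW.
have simP s : size s = K -> simplex R K.+1 (vec s).
  move=> sK; apply: simplex_complete; rewrite ?size_map//.
    by move=> y /mapP[j _ ->]; exact: ltW.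
  by rewrite big_map (le_trans (sum_p s))// sK; move: hK; lra.
have := minimax_risk_mixtures mu0_ge0 mu1_ge0 S0 S1 simP TV
  (varT mu0 mu0_ge0 S0 m20) (varT mu1 mu1_ge0 S1 m21).
apply: le_trans; rewrite lee_fin.
have -> : T mu1 - T mu0 = A * (K%:R * b) * \sum_j (mu1 j - mu0 j) * x j `^ alpha.
  under eq_bigr do rewrite mulrBl.
  by rewrite sumrB /T; ring.
move: gapE; set g := \sum_j _ => gapE.
have gg : gap ^+ 2 <= g ^+ 2.
  by rewrite lerXn2r ?nnegrE//; [exact: ltW|exact: le_trans (ltW gap0) gapE].
have u0 : 0 <= A ^+ 2 * (K%:R * b) ^+ 2 by rewrite -exprMn sqr_ge0.
have := ler_wpM2l u0 gg; move: (K%:R * b) {u0}; clear=> y; lra.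
Qed.

End PriorBound.

(** * The lower bound of order 1 / n *)

Section ParametricBound.
Variable R : realType.

(** Two slots in H let the same formula compute masses, theta and the chi-square sum. *)
Lemma sum_swap2_ends (H : R -> R -> R) K (t a b a' b' : R) :
  \sum_(i < K.+2) H (swap2 (fun=> t) ord0 ord_max a b i)
                    (swap2 (fun=> t) ord0 ord_max a' b' i)
  = H a a' + K%:R * H t t + H b b'.
Proof.
have mid u v (i : 'I_K) :
    swap2 (fun=> t) ord0 ord_max u v (lift ord0 (widen_ord (leqnSn K) i)) = t.
  by rewrite /swap2 -!val_eqE /= /bump /= add1n eqSS ltn_eqF.
rewrite big_ord_recl big_ord_recr /= addrA; congr (_ + _ + _).
  by rewrite (eq_bigr (fun=> H t t)) ?sumr_const ?card_ord ?mulr_natl// => i _; rewrite !mid.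
by rewrite /swap2 -!val_eqE /= /bump /= add1n eqxx.
Qed.

(** A mass d is moved from the last coordinate to the first, which is so small that the steep slope
    of A x^alpha there outweighs all other changes of theta. *)
Lemma parametric_bound (alpha A L : R) (phi : R -> R) :
  0 < alpha < 1 -> A != 0 -> 0 <= L ->
  (forall p q, 0 < p < 1 -> 0 < q < 1 ->
    `|(phi p - A * p `^ alpha) - (phi q - A * q `^ alpha)| <= L * `|p - q|) ->
  exists2 c : R, 0 < c & forall n k : nat, (0 < n)%N -> (2 <= k)%N ->
    ((c / n%:R)%:E <= minimax_risk R n k phi)%E.
Proof.
move=> al01 A0 L0 dec; have /andP[a0 a1] := al01.
have nA : 0 < `|A| by rewrite normr_gt0.
pose B := `|A| * (alpha * (1 / 4) `^ (alpha - 1)).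
have B0 : 0 <= B by rewrite !mulr_ge0 ?powR_ge0 ?(ltW a0).
have q0 : 0 < 1 / 4 :> R by lra.
(* Below y the slope of A x^alpha is at least 1 + 2L + B in absolute value: L is lost at the first
   coordinate, B + L at the last, and a change of at least d remains. *)
have [y /andP[y0 y4] yC] := exists_powR_ge ((1 + 2 * L + B) / (`|A| * alpha)) a1 q0.
pose s := y / 2.
exists (s ^+ 2 / 32); first by rewrite divr_gt0 ?exprn_gt0// /s; lra.
move=> n [|[|K]]// n0 _.
have s0 : 0 < s by rewrite /s; lra.
have s8 : s <= 1 / 8 by rewrite /s; lra.
pose N : R := n%:R; have N1 : 1 <= N by rewrite ler1n.
have N0 : 0 < N by lra.
(* Then s + d <= y, and d^2 (1/s + 1/q) <= 1 / (2n), so the n-th power of the chi-square sum is at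
   most e^(1/2) <= 2. *)
pose d := s / 2 / Num.sqrt N.
have sN : 1 <= Num.sqrt N by rewrite -sqrtr1 ler_sqrt.
have d0 : 0 < d by rewrite divr_gt0//; lra.
have ds : d <= s / 2 by rewrite ler_pdivrMr ?ler_peMr//; lra.
have d2 : d ^+ 2 = s ^+ 2 / (4 * N).
  by rewrite /d !expr_div_n sqr_sqrtr ?(ltW N0)//; field; lra.
clearbody d; clear sN.
(* The middle coordinates must be positive, as [P0] is divided by, and small enough to leave q >=
   3/4. *)
pose t := s / K.+1%:R.
have t0 : 0 < t by rewrite divr_gt0.
have Kt : 0 <= K%:R * t <= s.
  rewrite mulr_ge0 ?(ltW t0)//= /t mulrCA ler_piMr ?(ltW s0)//.
  by rewrite ler_pdivrMr// mul1r ler_nat.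
pose q := 1 - s - K%:R * t.
have q34 : 3 / 4 <= q < 1 by rewrite /q; move: Kt s8 s0; move: (K%:R * t) => z; lra.
pose P0 := swap2 (fun=> t) (ord0 : 'I_K.+2) ord_max s q.
pose P1 := swap2 (fun=> t) (ord0 : 'I_K.+2) ord_max (s + d) (q - d).
have P0_gt0 i : 0 < P0 i.
  by rewrite /P0 /swap2; case: eqP => // _; case: eqP => // _; move: q34; lra.
have P1_ge0 i : 0 <= P1 i.
  rewrite /P1 /swap2; case: eqP => _; first by lra.
  by case: eqP => _; [move: q34; lra|exact: ltW].
have S0 : \sum_i P0 i = 1.
  rewrite (sum_swap2_ends (fun u _ => u) K t s q s q) /q; ring.
have S1 : \sum_i P1 i = 1.
  rewrite (sum_swap2_ends (fun u _ => u) K t _ _ s q) /q; ring.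
have chi2 : \sum_i P1 i ^+ 2 / P0 i = 1 + d ^+ 2 * (s^-1 + q^-1).
  rewrite (sum_swap2_ends (fun u v => v ^+ 2 / u) K t s q (s + d) (q - d)).
  have -> : t ^+ 2 / t = t by field; lra.
  have -> : K%:R * t = 1 - s - q by rewrite /q; ring.
  by field; move: q34; lra.
have TV : \sum_(M : histo n K.+2 | is_histo n K.+2 M)
    `|multinom_pmf R n K.+2 P1 M - multinom_pmf R n K.+2 P0 M| <= 1.
  apply: le_trans (sum_norm_multinom_pmf_sub n P0_gt0 P1_ge0 S0 S1) _.
  rewrite chi2 ler_pdivrMr// mul1r.
  apply: (@le_trans _ _ (expR (1 / 2))); last first.
    rewrite -[leRHS]invrK -[1 / 2]opprK expRN lef_pV2 ?posrE ?expR_gt0//.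
    by apply: le_trans (expR_ge1Dx _); lra.
  have -> : 1 / 2 = (1 / (2 * N)) * N by field; lra.
  rewrite [X in expR X]mulrC /N expRM_natl lerXn2r ?nnegrE ?expR_ge0//.
    have : 0 <= d ^+ 2 * (s^-1 + q^-1).
      by rewrite mulr_ge0 ?sqr_ge0// addr_ge0 ?invr_ge0; move: q34; lra.
    by lra.
  apply: le_trans (expR_ge1Dx _); rewrite lerD2l d2.
  have qV : q^-1 <= 2 by rewrite -[leRHS]invrK lef_pV2 ?posrE; move: q34; lra.
  have -> : 1 / (2 * n%:R) = (4 * N)^-1 * 2 :> R by rewrite /N; field; lra.
  rewrite mulrAC [leLHS]mulrC ler_wpM2l ?invr_ge0 ?mulrDr//; first by lra.
  have -> : s ^+ 2 / s = s by field; lra.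
  have : s ^+ 2 * q^-1 <= s ^+ 2 * 2 by rewrite ler_wpM2l ?sqr_ge0.
  by nra.
have sim0 : simplex R K.+2 P0 by split => // i; exact: ltW.
have := minimax_risk_two_points phi sim0 (conj P1_ge0 S1) TV.
apply: le_trans; rewrite lee_fin.
have -> : theta R K.+2 phi P1 - theta R K.+2 phi P0
    = (phi (s + d) - phi s) + (phi (q - d) - phi q).
  rewrite /theta (sum_swap2_ends (fun u _ => phi u) K t _ _ s q).
  by rewrite (sum_swap2_ends (fun u _ => phi u) K t _ _ s q); ring.
set D := _ + _.
suff dD : d <= `|D|.
  have : d ^+ 2 <= `|D| ^+ 2 by rewrite lerXn2r ?nnegrE// ltW.
  rewrite real_normK ?num_real// d2 => H.
  apply: le_trans (ler_wpM2r _ H) => //; rewrite le_eqVlt; apply/orP; left.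
  by apply/eqP; rewrite -/N; field; lra.
have e1 : `|phi (q - d) - phi q| <= (B + L) * d.
  have H1 : 1 / 4 <= q - d < 1 by move: q34; lra.
  have H2 : 1 / 4 <= q < 1 by move: q34; lra.
  have := lipschitz_away_from_0 al01 q0 dec H1 H2.
  have -> : q - d - q = - d by ring.
  by rewrite normrN (gtr0_norm d0).
have e2 : `|(phi (s + d) - A * (s + d) `^ alpha) - (phi s - A * s `^ alpha)| <= L * d.
  have H1 : 0 < s + d < 1 by lra.
  have H2 : 0 < s < 1 by lra.
  have := dec _ _ H1 H2; have -> : s + d - s = d by ring.
  by rewrite (gtr0_norm d0).
have e3 : (1 + 2 * L + B) * d <= `|A * ((s + d) `^ alpha - s `^ alpha)|.
  have al : 0 <= alpha <= 1 by rewrite !ltW.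
  have sd : s <= s + d by rewrite lerDl ltW.
  have := powR_increment_ge al s0 sd; have -> : s + d - s = d by ring.
  move=> inc.
  have inc0 : 0 <= (s + d) `^ alpha - s `^ alpha.
    by rewrite subr_ge0 ge0_ler_powR ?nnegrE ?(ltW a0) ?(ltW s0)// ltW ?addr_gt0.
  rewrite normrM (ger0_norm inc0).
  apply: le_trans (ler_wpM2l (ltW nA) inc); rewrite !mulrA ler_pM2r//.
  rewrite -ler_pdivrMl ?mulr_gt0// [leLHS]mulrC.
  apply: le_trans yC _; rewrite -[alpha - 1]opprB !powRN lef_pV2 ?posrE ?powR_gt0//; last by lra.
  by rewrite ge0_ler_powR ?nnegrE; rewrite /s in ds *; lra.
have -> : D = A * ((s + d) `^ alpha - s `^ alpha)
   - (- ((phi (s + d) - A * (s + d) `^ alpha) - (phi s - A * s `^ alpha))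
      - (phi (q - d) - phi q)) by rewrite /D; ring.
apply: le_trans (lerB_normD _ _); rewrite lerBrDr.
apply: le_trans e3; rewrite normrN.
apply: le_trans (lerD (lexx _) (ler_normB _ _)) _; rewrite normrN.
by apply: le_trans (lerD (lexx _) (lerD e2 e1)) _; nra.
Qed.

End ParametricBound.

(** * Logarithms against powers *)

Section Growth.
Variable R : realType.
Implicit Types x d : R.

Lemma ln_le_powR x d : 0 < x -> 0 < d -> ln x <= d^-1 * x `^ d.
Proof.
move=> x0 d0; rewrite ler_pdivlMl// -ln_powR.
by apply: ltW; apply: ln_sublinear; exact: powR_gt0.
Qed.

Lemma exists_nat_ceil x : 0 <= x -> exists2 m : nat, (0 < m)%N & x <= m%:R <= x + 1.
Proof.
move=> x0; exists (Num.truncn x).+1 => //.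
have /andP[tx xt] := truncn_itv x0.
by rewrite (ltW xt) -natr1 lerD2r.
Qed.

Lemma powR_invr x d : 0 <= x -> x^-1 `^ d = (x `^ d)^-1.
Proof. by move=> x0; rewrite -powR_inv1// powRAC powR_inv1 ?powR_ge0. Qed.

(** This is X <= eta a^alpha for the later choice of a and X. With m = O(n^d) the quotient of the
    two sides is O(n^(d - 1 + (1 + d) alpha)), and d = (1 - alpha) / 4 makes the exponent at most
    -(1 - alpha) / 2. *)
Lemma log_over_power_le (alpha r eta : R) : 0 < alpha < 1 -> 1 <= r -> 0 < eta ->
  exists n0 : R, forall n m : R, n0 <= n -> 1 <= n -> 0 < m -> m <= 4 * ln n ->
    m / (2 * r * n) <= eta * (4 * r * n * m)^-1 `^ alpha.
Proof.
move=> /andP[a0 a1] r1 eta0.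
have r0 : 0 < r by lra.
pose d := (1 - alpha) / 4; have d0 : 0 < d by rewrite /d; lra.
pose M := 4 * d^-1; have M0 : 0 < M by rewrite mulr_gt0 ?invr_gt0.
pose b := (1 - alpha) / 2; have b0 : 0 < b by rewrite /b; lra.
pose Q := M * (4 * r * M) `^ alpha / eta.
have rM : 0 < 4 * r * M by apply: mulr_gt0 => //; exact: mulr_gt0.
have Q0 : 0 < Q by rewrite divr_gt0// mulr_gt0// powR_gt0.
exists (Q `^ b^-1) => n m n0n n1 m0 mn.
have n0 : 0 < n by lra.
have mM : m <= M * n `^ d.
  by rewrite (le_trans mn)// /M -mulrA ler_pM2l// ln_le_powR.
have nb : Q <= n `^ b.
  have : (Q `^ b^-1) `^ b <= n `^ b.
    by rewrite ge0_ler_powR ?nnegrE ?powR_ge0 ?(ltW b0) ?(ltW n0).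
  by rewrite -powRrM mulVf ?gt_eqF// powRr1// ltW.
have nm0 : 0 < 4 * r * n * m by rewrite !mulr_gt0.
rewrite (powR_invr _ (ltW nm0)) ler_pdivlMr ?powR_gt0//.
have H1 : (4 * r * n * m) `^ alpha <= (4 * r * M) `^ alpha * n `^ ((1 + d) * alpha).
  rewrite powRrM -powRM ?powR_ge0 ?(ltW rM)//.
  rewrite ge0_ler_powR ?nnegrE ?(ltW a0) ?(ltW nm0)//.
    by rewrite mulr_ge0 ?powR_ge0 ?ltW.
  rewrite powRD ?powRr1 ?(ltW n0)//; last by apply/implyP => _; rewrite gt_eqF.
  have -> : 4 * r * M * (n * n `^ d) = 4 * r * n * (M * n `^ d) by ring.
  by rewrite ler_pM2l// !mulr_gt0.
have H2 : m / (2 * r * n) <= M * n `^ (d - 1).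
  rewrite powRB; last by apply/implyP => _; rewrite gt_eqF.
  rewrite powRr1 ?(ltW n0)// mulrA ler_pM ?invr_ge0 ?(ltW m0)//.
    by rewrite ltW// !mulr_gt0.
  by rewrite lef_pV2 ?posrE ?mulr_gt0// ler_peMl ?(ltW n0)//; lra.
have n2 : 0 <= m / (2 * r * n) by rewrite divr_ge0 ?(ltW m0)// ltW// !mulr_gt0.
apply: le_trans (ler_pM n2 (powR_ge0 _ _) H2 H1) _.
have -> : M * n `^ (d - 1) * ((4 * r * M) `^ alpha * n `^ ((1 + d) * alpha))
    = Q * eta * n `^ (d - 1 + (1 + d) * alpha).
  rewrite [in RHS]powRD; last by apply/implyP => _; rewrite gt_eqF.
  by rewrite /Q divfK ?gt_eqF//; ring.
rewrite [Q * _]mulrC -mulrA ler_piMr ?(ltW eta0)//.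
rewrite -ler_pdivlMl// mulr1.
apply: (@le_trans _ _ (n `^ (- b))).
  by rewrite ler_powR// /b /d; nra.
by rewrite powRN lef_pV2 ?posrE ?powR_gt0.
Qed.

End Growth.

(** * Choice of parameters in the two regimes *)

Section Regimes.
Variable R : realType.

Lemma le_powR_div_ln (alpha : R) (k : nat) : 0 < alpha < 1 -> (2 <= k)%N ->
  1 <= k%:R `^ alpha^-1 / ln k%:R.
Proof.
move=> /andP[a0 a1] k2; have k1 : 1 < k%:R :> R by rewrite ltr1n.
rewrite ler_pdivlMr ?mul1r ?ln_gt0// (@le_trans _ _ k%:R)//.
  by apply/ltW/ln_sublinear; lra.
by rewrite le1r_powR ?(ltW k1)// invf_ge1// ltW.
Qed.

(** Bootstrap: the crude bound ln k <= 2 sqrt k first gives k <= 4 n^2, hence ln k <= 3 ln n, which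
    is put back into k^(1/alpha) <= n ln k. *)
Lemma support_size_bounds (alpha n : R) (k : nat) : 0 < alpha < 1 -> (2 <= k)%N ->
  8 <= n -> k%:R `^ alpha^-1 / ln k%:R <= n ->
  2 * k%:R <= n ^+ 3 /\ k%:R <= (3 * n * ln n) `^ alpha.
Proof.
move=> /andP[a0 a1] k2 n8.
have k1 : 1 < k%:R :> R by rewrite ltr1n.
have k0 : 0 < k%:R :> R by lra.
have lk0 : 0 < ln k%:R :> R by rewrite ln_gt0.
rewrite ler_pdivrMr// => kn.
pose t := Num.sqrt (k%:R : R).
have t0 : 0 < t by rewrite sqrtr_gt0.
have tk : t ^+ 2 = k%:R by rewrite sqr_sqrtr// ltW.
have lkt : ln k%:R <= 2 * t.
  have half_gt0 : 0 < 2^-1 :> R by rewrite invr_gt0.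
  by have := ln_le_powR k0 half_gt0; rewrite invrK powR12_sqrt ?(ltW k0).
have kka : k%:R <= k%:R `^ alpha^-1 :> R.
  by rewrite le1r_powR ?(ltW k1)// invf_ge1// ltW.
have tn : t <= 2 * n.
  rewrite -(ler_pM2r t0) -expr2 tk (le_trans kka)// (le_trans kn)//.
  have -> : 2 * n * t = n * (2 * t) by ring.
  by rewrite ler_pM2l//; lra.
have k4 : k%:R <= 4 * n ^+ 2.
  have -> : 4 * n ^+ 2 = (2 * n) ^+ 2 by ring.
  by rewrite -tk lerXn2r ?nnegrE ?(ltW t0)//; lra.
have nn : 8 * n ^+ 2 <= n ^+ 3 by rewrite [n ^+ 3]exprS ler_wpM2r ?sqr_ge0.
split; first by lra.
have kn3 : k%:R <= n ^+ 3 by lra.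
have lk3 : ln k%:R <= 3 * ln n.
  by rewrite mulr_natl -lnXn ?ler_ln ?posrE ?exprn_gt0//; lra.
have -> : k%:R = (k%:R `^ alpha^-1) `^ alpha :> R.
  by rewrite -powRrM mulVf ?gt_eqF// powRr1 ?(ltW k0).
rewrite ge0_ler_powR ?nnegrE ?powR_ge0 ?(ltW a0)//.
  by rewrite !mulr_ge0// ?ln_ge0; lra.
rewrite (le_trans kn)//; have -> : 3 * n * ln n = n * (3 * ln n) by ring.
by rewrite ler_pM2l//; lra.
Qed.

Section Phi.
Variables (alpha A L : R) (phi : R -> R).
Hypotheses (al01 : 0 < alpha < 1) (A_neq0 : A != 0) (L_ge0 : 0 <= L).
Hypothesis dec : forall p q, 0 < p < 1 -> 0 < q < 1 ->
  `|(phi p - A * p `^ alpha) - (phi q - A * q `^ alpha)| <= L * `|p - q|.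

(** Since 2 alpha > 1, k^2 = O((ln n)^6) is O(n^(2 alpha - 1)), and the claimed rate is O(1 / n).
    The 6 in d matches the sixth power of the logarithm. *)
Lemma parametric_regime (B : R) : 1 / 2 < alpha -> 0 < B ->
  exists2 C : R, 0 < C & forall n k : nat, (2 <= k)%N -> 1 <= ln n%:R :> R ->
    k%:R <= B * ln n%:R ^+ 3 ->
    ((C * (k%:R ^+ 2 / (n%:R * ln n%:R) `^ (2 * alpha)))%:E <= minimax_risk R n k phi)%E.
Proof.
move=> a12 B0; have [c c0 bound] := parametric_bound al01 A_neq0 L_ge0 dec.
pose d := (2 * alpha - 1) / 6; have d0 : 0 < d by rewrite /d; lra.
pose D := B ^+ 2 * d^-1 ^+ 6.
have D0 : 0 < D by rewrite mulr_gt0 ?exprn_gt0 ?invr_gt0.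
exists (c / D); first by rewrite divr_gt0.
move=> n k k2 ln1 kB.
have n0 : 0 < n%:R :> R.
  by rewrite ltNge; apply/negP => /ln0 H; move: ln1; rewrite H; lra.
apply: le_trans (bound n k _ k2); last by move: n0; rewrite ltr0n.
rewrite lee_fin; set l := ln n%:R in ln1 kB *; set N : R := n%:R in n0 *.
have l0 : 0 < l by lra.
have kD : k%:R ^+ 2 <= D * N `^ (2 * alpha - 1).
  have -> : N `^ (2 * alpha - 1) = (N `^ d) ^+ 6.
    by rewrite -powR_mulrn ?powR_ge0// -powRrM /d; congr (_ `^ _); field.
  apply: (@le_trans _ _ (B ^+ 2 * (d^-1 * N `^ d) ^+ 6)).
    apply: (@le_trans _ _ ((B * l ^+ 3) ^+ 2)).
      by rewrite lerXn2r ?nnegrE// mulr_ge0 ?exprn_ge0 ?ltW.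
    rewrite exprMn -exprM ler_pM2l ?exprn_gt0// lerXn2r ?nnegrE ?(ltW l0)//.
      by rewrite mulr_ge0 ?invr_ge0 ?powR_ge0 ?ltW.
    exact: ln_le_powR.
  by rewrite exprMn /D mulrA.
clearbody D.
have NE : N * N `^ (2 * alpha - 1) = N `^ (2 * alpha).
  by rewrite mulr_powRB1 ?(ltW n0)//; lra.
have Nl : N `^ (2 * alpha) <= (N * l) `^ (2 * alpha).
  rewrite ge0_ler_powR ?nnegrE ?mulr_ge0 ?(ltW n0) ?(ltW l0)//; first by lra.
  by rewrite ler_peMr ?(ltW n0).
have P0 : 0 < (N * l) `^ (2 * alpha) by rewrite powR_gt0// mulr_gt0.
set P := (N * l) `^ (2 * alpha) in Nl P0 *.
have -> : c / D * (k%:R ^+ 2 / P) = c * (k%:R ^+ 2 / (D * P)).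
  by field; rewrite !gt_eqF.
rewrite ler_pM2l// ler_pdivrMr ?mulr_gt0//. rewrite ler_pdivlMl//.
apply: (@le_trans _ _ (D * N `^ (2 * alpha))); last by rewrite ler_pM2l.
by rewrite -NE [leRHS]mulrCA ler_pM2l.
Qed.

(** The bound ln n >= 1 stands before the condition on k because the parametric regime also relies
    on it. *)
Lemma mixture_regime :
  exists c0 B C : R, [/\ 0 < c0, 0 < B, 0 < C &
  forall n k : nat, (2 <= k)%N -> c0 * (k%:R `^ alpha^-1 / ln k%:R) <= n%:R ->
    1 <= ln n%:R :> R /\
    (B * ln n%:R ^+ moment_exponent alpha <= k%:R ->
    ((C * (k%:R ^+ 2 / (n%:R * ln n%:R) `^ (2 * alpha)))%:E
       <= minimax_risk R n k phi)%E)].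
Proof.
have /andP[a0 a1] := al01.
have [B [c [eta [B0 c_gt0 eta0 bound]]]] := prior_bound al01 A_neq0 L_ge0 dec.
pose r : R := expR 2.
have r1 : 1 <= r by apply: le_trans (expR_ge1Dx _); lra.
have r0 : 0 < r by lra.
pose eta' := Num.min eta (1 / 2).
have eta'0 : 0 < eta' by rewrite lt_min eta0; lra.
have [n0 growth] := log_over_power_le al01 r1 eta'0.
pose c0 := Num.max n0 (Num.max 8 (expR 1)).
have c0_8 : 8 <= c0 by rewrite !le_max lexx orbT.
have c0_n0 : n0 <= c0 by rewrite le_max lexx.
have c0_e : expR 1 <= c0 by rewrite !le_max lexx !orbT.
clearbody c0.
have r16 : 0 < (16 * r) `^ (2 * alpha) by rewrite powR_gt0// mulr_gt0.
(* In 128 the factor 64 covers m <= 4 ln n up to the third power and 2 covers K + 1 >= k / 2. In C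
   the 4 has the same origin, and 16 r comes from 1 / a <= 16 r n ln n. *)
exists c0, (128 * B), (c / (4 * (16 * r) `^ (2 * alpha))); split.
- by lra.
- by rewrite mulr_gt0.
- by rewrite divr_gt0// mulr_gt0.
move=> n [|[|K]]// _ hn; set k := K.+2 in hn *.
have nc0 : c0 <= n%:R.
  by apply: le_trans hn; rewrite ler_peMr ?le_powR_div_ln//; lra.
have hk : k%:R `^ alpha^-1 / ln k%:R <= n%:R :> R.
  apply: le_trans hn; rewrite ler_peMl; [by []| |by lra].
  by apply: le_trans (le_powR_div_ln al01 _).
set N : R := n%:R in nc0 hk hn *.
have N8 : 8 <= N by lra.
have N0 : 0 < N by lra.
have ln1 : 1 <= ln N.
  by rewrite -[leLHS]expRK ler_ln ?posrE ?expR_gt0// (le_trans c0_e).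
split=> // hB.
have [k3 ka] := support_size_bounds al01 (isT : (2 <= k)%N) N8 hk.
have [m m_gt0 /andP[m3 m4]] : exists2 m : nat, (0 < m)%N & 3 * ln N <= m%:R <= 3 * ln N + 1.
  by apply: exists_nat_ceil; lra.
have m_gt0R : 0 < m%:R :> R by rewrite ltr0n.
have m4' : m%:R <= 4 * ln N by lra.
(* Now 2 r X = m / n, and 1 / a >= 3 n ln n yields k a^alpha <= 1. *)
pose a := (4 * r * N * m%:R)^-1.
have a_gt0 : 0 < a by rewrite invr_gt0 !mulr_gt0.
pose X := m%:R / (2 * r * N).
have XE : X = 2 * a * m%:R ^+ 2 by rewrite /X /a; field; lra.
have Xeta : X <= eta' * a `^ alpha by apply: growth => //; lra.
have aal : 0 < a `^ alpha by rewrite powR_gt0.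
have kaa : k%:R * a `^ alpha <= 1.
  rewrite (le_trans (ler_wpM2r (ltW aal) ka))// -powRM ?(ltW a_gt0)//; last first.
    by rewrite !mulr_ge0//; lra.
  rewrite -[leRHS](congr1 (fun f => f alpha) (@powR1 R)).
  rewrite ge0_ler_powR ?nnegrE ?(ltW a0)//.
    by rewrite !mulr_ge0 ?(ltW a_gt0)//; lra.
  rewrite /a ler_pdivrMr ?mul1r ?mulr_gt0//.
  have -> : 3 * N * ln N = N * (3 * ln N) by ring.
  have -> : 4 * r * N * m%:R = N * (4 * r * m%:R) by ring.
  by rewrite ler_pM2l// (le_trans m3)// ler_peMl ?(ltW m_gt0R)//; lra.
have Kk : K.+1%:R <= k%:R :> R by rewrite ler_nat.
have Kk2 : k%:R / 2 <= K.+1%:R :> R.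
  rewrite /k -[K.+2]addn2 -[K.+1]addn1 !natrD.
  by have : 0 <= K%:R :> R by []; move: (K%:R : R) => z; lra.
have X_half : X <= 1 / 2 * a `^ alpha.
  by rewrite (le_trans Xeta)// ler_pM2r// /eta' ge_min lexx orbT.
have X_eta : X <= eta * a `^ alpha.
  by rewrite (le_trans Xeta)// ler_pM2r// /eta' ge_min lexx.
have KX : K.+1%:R * X <= 1 / 2.
  apply: (@le_trans _ _ (k%:R * (1 / 2 * a `^ alpha))).
    by apply: ler_pM => //; rewrite /X divr_ge0// ltW// !mulr_gt0.
  by rewrite mulrCA ler_piMr.
(* The n-th power is at most e^m while r^(m+1) = e^(2m+2). The remaining e^-m is at most n^-3, as m
   >= 3 ln n, and absorbs 2 (K + 1) <= n^3. *)
have KTV : K.+1%:R * (2 / r ^+ m.+1 * (1 + 2 * (r * X)) ^+ n) <= 1.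
  have -> : 1 + 2 * (r * X) = 1 + m%:R / N by rewrite /X; field; lra.
  have H1 : (1 + m%:R / N) ^+ n <= expR m%:R.
    have -> : expR m%:R = expR (m%:R / N) ^+ n.
      by rewrite -expRM_natl; congr expR; rewrite /N; field; lra.
    rewrite lerXn2r ?nnegrE ?expR_ge0 ?expR_ge1Dx//.
    by rewrite addr_ge0// divr_ge0 ?ltW.
  have H2 : expR m%:R * N ^+ 3 <= r ^+ m.+1.
    have -> : N ^+ 3 = expR (3 * ln N) by rewrite expRM_natl lnK.
    rewrite -expRD /r -expRM_natl ler_expR -natr1.
    by move: m3 m_gt0R; lra.
  have rm : 0 < r ^+ m.+1 by rewrite exprn_gt0.
  have H3 : K.+1%:R * 2 <= N ^+ 3 by lra.
  rewrite mulrA mulrA mulrAC ler_pdivrMr// mul1r.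
  apply: le_trans H2; rewrite mulrC; apply: ler_pM => //.
  by rewrite exprn_ge0// addr_ge0// divr_ge0 ?ltW.
have KB : B * m%:R ^+ moment_exponent alpha <= K.+1%:R.
  apply: le_trans Kk2; rewrite ler_pdivlMr//; apply: le_trans hB.
  have -> : 128 * B * ln N ^+ moment_exponent alpha
      = B * (64 * ln N ^+ moment_exponent alpha) * 2 by ring.
  rewrite ler_pM2r// ler_pM2l//.
  apply: (@le_trans _ _ ((4 * ln N) ^+ moment_exponent alpha)).
    by rewrite lerXn2r ?nnegrE ?(ltW m_gt0R)//; lra.
  rewrite exprMn ler_wpM2r ?exprn_ge0//; first by lra.
  by rewrite /moment_exponent; case: ifP => _; lra.
have := bound n m K.+1 a r X m_gt0 a_gt0 r1 XE KX KTV X_eta KB.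
apply: le_trans; rewrite lee_fin -/k.
have Nl : 0 < N * ln N by rewrite mulr_gt0//; lra.
have P0 : 0 < (N * ln N) `^ (2 * alpha) by rewrite powR_gt0.
have aa : ((16 * r) `^ (2 * alpha) * (N * ln N) `^ (2 * alpha))^-1 <= (a `^ alpha) ^+ 2.
  rewrite -powRM ?(ltW Nl) ?mulr_ge0 ?(ltW r0)//.
  have p4 : 0 < 4 * r * N * m%:R by rewrite !mulr_gt0.
  have -> : (a `^ alpha) ^+ 2 = ((4 * r * N * m%:R) `^ (2 * alpha))^-1.
    rewrite -powR_mulrn ?powR_ge0// -powRrM [alpha * 2]mulrC.
    exact: powR_invr (ltW p4).
  have p16 : 0 < 16 * r * (N * ln N) by rewrite !mulr_gt0//; lra.
  rewrite lef_pV2 ?posrE ?powR_gt0// ge0_ler_powR ?nnegrE ?(ltW p4) ?(ltW p16)//.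
    by lra.
  have -> : 16 * r * (N * ln N) = 4 * r * N * (4 * ln N) by ring.
  by rewrite ler_pM2l// !mulr_gt0.
rewrite exprMn.
have -> : c / (4 * (16 * r) `^ (2 * alpha)) * (k%:R ^+ 2 / (N * ln N) `^ (2 * alpha))
    = c * ((k%:R / 2) ^+ 2 * ((16 * r) `^ (2 * alpha) * (N * ln N) `^ (2 * alpha))^-1).
  by field; rewrite !gt_eqF.
rewrite ler_pM2l// ler_pM ?sqr_ge0//; first by rewrite invr_ge0 ltW// mulr_gt0.
by rewrite lerXn2r ?nnegrE ?divr_ge0.
Qed.

End Phi.
End Regimes.

(** * Assembly of the regimes *)

Unset Implicit Arguments.

Theorem theorem4 (R : realType) (alpha : R) (phi phi1 phi2 : R -> R) :
  0 < alpha < 1 ->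
  (forall p, 0 <= p <= 1 -> 0 <= phi p) ->
  @C2_on_I01 R phi phi1 phi2 ->
  (exists W c c' : R, 0 < W /\
     forall p, 0 < p <= 1 ->
       (2 - alpha) * W * p `^ (alpha - 2) + c' <= `|phi2 p|
       /\ `|phi2 p| <= (2 - alpha) * W * p `^ (alpha - 2) + c) ->
  exists c0 c1 C : R, 0 < c0 /\ 0 < c1 /\ 0 < C /\
    forall n k : nat, (2 <= k)%N ->
      c0 * (k%:R `^ (alpha^-1) / ln k%:R) <= n%:R ->
      (alpha <= 1/2 -> c1 * (ln n%:R) `^ (4/3) <= k%:R) ->
      ((C * (k%:R ^+ 2 / (n%:R * ln n%:R) `^ (2 * alpha)))%:E
         <= @minimax_risk R n k phi)%E.
Proof.
move=> al01 _ C2 bnd.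
have [A [L [A0 L0 dec]]] := power_plus_lipschitz al01 C2 bnd.
have [c0 [B [C [c0_gt0 B0 C0 mixt]]]] := mixture_regime al01 A0 L0 dec.
have [a12|a12] := leP alpha (1 / 2).
  exists c0, B, C; do 3!split=> //; move=> n k k2 hn hk.
  have [ln1 mixtk] := mixt n k k2 hn; apply: mixtk.
  apply: (le_trans _ (hk isT)); rewrite ler_pM2l// /moment_exponent a12 expr1.
  (* The power 4/3 dominates the first power because ln n >= 1. *)
  by rewrite le1r_powR//; lra.
have [C' C'0 para] := parametric_regime al01 A0 L0 dec a12 B0.
exists c0, 1, (Num.min C C'); do 3!split=> //; first by rewrite lt_min C0.
move=> n k k2 hn _; have [ln1 mixtk] := mixt n k k2 hn.
have Q0 : 0 <= k%:R ^+ 2 / (n%:R * ln n%:R) `^ (2 * alpha).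
  by rewrite divr_ge0 ?sqr_ge0 ?powR_ge0.
(* For alpha > 1/2 the third power of ln n separates the parametric regime from the mixture
   regime. *)
have [kB|Bk] := leP (k%:R) (B * ln n%:R ^+ 3).
  apply: le_trans (para n k k2 ln1 kB).
  by rewrite lee_fin ler_wpM2r// ge_min lexx orbT.
apply: (@le_trans _ _ (C * (k%:R ^+ 2 / (n%:R * ln n%:R) `^ (2 * alpha)))%:E).
  by rewrite lee_fin ler_wpM2r// ge_min lexx.
have e3 : moment_exponent alpha = 3%N by rewrite /moment_exponent leNgt a12.
by apply: mixtk; rewrite e3 ltW.
Qed.
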